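(* Let $\Bbbk$ be an algebraically closed field of characteristic $0$, let $n\ge 1$, and let $A$ be the incidence algebra over $\Bbbk$ of the symmetric group $\mathfrak{S}_n$ partially ordered by the Bruhat order. Let $v\in\mathfrak{S}_n$ be a boolean permutation and let $L_v$ be the simple $A$-module indexed by $v$. Then $\mathbf{grade}(L_v)=\mathbf{a}(v)$, where $\mathbf{a}$ is Lusztig's $\mathbf{a}$-function.
   Context: $\mathfrak{S}_n$ is the Coxeter group with simple reflections $\sigma_i=(i,i+1)$, $i\in[1,n-1]$; $\ell$ is the Coxeter length. A permutation $v$ is boolean if its principal order ideal $\{u: u\le v\}$ in the Bruhat order is isomorphic to a boolean lattice (equivalently, reduced words of $v$ have no repeated letters). The incidence algebra $A=\mathcal{I}(\mathfrak{S}_n,\le)$ is the path algebra of the quiver whose vertices are the elements of $\mathfrak{S}_n$ with an arrow $p\to q$ whenever $p$ covers $q$, modulo the relations that any two paths with the same start and end coincide. For $p\in\mathfrak{S}_n$, the simple module $L_p$ is one-dimensional at vertex $p$, zero elsewhere, with all arrows acting by zero. All modules are finite-dimensional left modules. For a nonzero module $M$, $\mathbf{grade}(M)=\min\{i: \mathrm{Ext}^i_A(M,A)\neq 0\}$. Lusztig's $\mathbf{a}$-function $\mathbf{a}:\mathfrak{S}_n\to\mathbb{Z}_{\ge0}$ (defined by Lusztig via the Kazhdan–Lusztig basis of the Hecke algebra) is, for $\mathfrak{S}_n$, the unique function that is constant on two-sided Kazhdan–Lusztig cells (i.e. on sets of permutations having the same Robinson–Schensted shape) and satisfies $\mathbf{a}(w)=\ell(w)$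 whenever $w$ is the longest element of a parabolic subgroup generated by a subset of the simple reflections. *)

(* Defs.v *)
From HB Require Import structures.
From mathcomp Require Import all_boot all_order all_algebra all_fingroup.
Set Implicit Arguments. Unset Strict Implicit. Unset Printing Implicit Defensive.
Import GRing.Theory.
Local Open Scope ring_scope.

Section Sn.
Variable n : nat.
Notation Sn := {perm 'I_n}.

Definition coxlen (w : Sn) : nat :=
  #|[set ij : 'I_n * 'I_n | (ij.1 < ij.2)%N && (w ij.2 < w ij.1)%N]|.

Definition sigma (i : 'I_n) : Sn := tperm i (insubd i i.+1).
Definition valid_word (s : seq 'I_n) : bool := all (fun i : 'I_n => (i.+1 < n)%N) s.
Definition word_prod (s : seq 'I_n) : Sn := (\prod_(i <- s) sigma i)%g.
Definition reduced_word_of (w : Sn) (s : seq 'I_n) : Prop :=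
  valid_word s /\ word_prod s = w /\ size s = coxlen w.

Definition boolean_perm (v : Sn) : Prop :=
  forall s, reduced_word_of v s -> uniq s.

Definition bruhat_step : rel Sn := fun u v =>
  [exists i : 'I_n, exists j : 'I_n, (i != j) && (v == (u * tperm i j)%g)]
  && (coxlen u < coxlen v)%N.
Definition bruhat_le (u v : Sn) : bool := connect bruhat_step u v.
Definition bruhat_lt (u v : Sn) : bool := (u != v) && bruhat_le u v.

Fixpoint rs_bump (x : nat) (r : seq nat) : seq nat * option nat :=
  match r with
  | [::] => ([:: x], None)
  | y :: r' => if (x < y)%N then (x :: r', Some y)
               else let: (r2, o) := rs_bump x r' in (y :: r2, o)
  end.
Fixpoint rs_insert (x : nat) (t : seq (seq nat)) : seq (seq nat) :=
  match t with
  | [::] => [:: [:: x]]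
  | r :: t' => let: (r2, o) := rs_bump x r in
               match o with None => r2 :: t' | Some y => r2 :: rs_insert y t' end
  end.
Definition rs_P (w : Sn) : seq (seq nat) :=
  foldl (fun t x => rs_insert x t) [::] [seq val (w i) | i <- enum 'I_n].
Definition rs_shape (w : Sn) : seq nat := map size (rs_P w).

Definition parabolic (J : {set 'I_n}) : {set Sn} :=
  <<[set sigma j | j in J & (j.+1 < n)%N]>>%g.
Definition is_longest_parabolic (u : Sn) : bool :=
  [exists J : {set 'I_n}, (u \in parabolic J) &&
     [forall w in parabolic J, (coxlen w <= coxlen u)%N]].

(* Lusztig's a-function on S_n: constant on two-sided cells (= RS shape classes)
   and equal to the length on longest elements of parabolic subgroups. *)
Definition a_fun (w : Sn) : nat :=
  match [pick u | is_longest_parabolic u && (rs_shape u == rs_shape w)] with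
  | Some u => coxlen u
  | None => 0%N
  end.

(* ---- Incidence algebra of (S_n, Bruhat) and its modules ----
   The incidence algebra has basis [p -> q] for q <= p (paths p -> q in the
   Hasse quiver), with [q' -> r][p -> q] = (q' == q) [p -> r].
   A finite-dimensional left module of dimension d is a unital algebra map,
   given by act p q : 'M_d, the action of [p -> q] on column vectors. *)
Variable F : fieldType.

Definition is_Amodule (d : nat) (act : Sn -> Sn -> 'M[F]_d) : Prop :=
  [/\ forall p q, ~~ bruhat_le q p -> act p q = 0,
      \sum_(p : Sn) act p p = 1%:M,
      forall p q r, bruhat_le q p -> bruhat_le r q -> act q r *m act p q = act p r
    & forall p q q' r, q != q' -> act q' r *m act p q = 0].

Definition simple_act (v : Sn) : Sn -> Sn -> 'M[F]_1 :=
  fun p q => ((p == v) && (q == v))%:R%:M.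

Definition reg_basis : {set Sn * Sn} := [set x | bruhat_le x.2 x.1].
Definition reg_dim : nat := #|reg_basis|.
Definition reg_act : Sn -> Sn -> 'M[F]_reg_dim := fun p q =>
  \matrix_(i, j)
    (bruhat_le q p && ((enum_val j).2 == p) &&
     (enum_val i == ((enum_val j).1, q)))%:R.

(* ---- Ext via the normalized bar resolution relative to the semisimple
   subalgebra E = span{[x -> x]}:  P_i = A (x)_E rad(A)^{(x)_E i} (x)_E M.
   Hom_A(P_i, N) = Hom_E(rad^{(x) i} (x)_E M, N)
     = prod over chains x0 < x1 < ... < xi of Hom_F(e_{xi} M, e_{x0} N). *)
Definition is_chain (c : seq Sn) : bool := sorted bruhat_lt c.

Section Ext.
Variables (dM : nat) (actM : Sn -> Sn -> 'M[F]_dM)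
          (dN : nat) (actN : Sn -> Sn -> 'M[F]_dN).

Definition cochain (i : nat) (f : seq Sn -> 'M[F]_(dN, dM)) : Prop :=
  forall c, is_chain c -> size c = i.+1 ->
    f c = actN (head 1%g c) (head 1%g c) *m f c *m actM (last 1%g c) (last 1%g c).

(* coboundary of a degree (i-1) cochain g, evaluated at a chain of size i+1
   (i >= 1): (dg)(a1,..,ai,m) = a1 g(a2..ai,m)
       + sum_{j=1}^{i-1} (-1)^j g(..,a_j a_{j+1},..,m) + (-1)^i g(a1..a_{i-1}, a_i m) *)
Definition cobound (i : nat) (g : seq Sn -> 'M[F]_(dN, dM)) (c : seq Sn)
  : 'M[F]_(dN, dM) :=
  actN (nth 1%g c 1) (nth 1%g c 0) *m g (behead c)
  + \sum_(1 <= j < i) (-1) ^+ j *: g (take j c ++ drop j.+1 c)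
  + (-1) ^+ i *: (g (take i c) *m actM (nth 1%g c i) (nth 1%g c i.-1)).

Definition Ext_nonzero (i : nat) : Prop :=
  exists f, [/\ cochain i f,
    (forall c, is_chain c -> size c = i.+2 -> cobound i.+1 f c = 0) &
    ~ (match i with
       | 0 => forall c, is_chain c -> size c = 1%N -> f c = 0
       | i'.+1 => exists g, cochain i' g /\
           forall c, is_chain c -> size c = i.+1 -> f c = cobound i g c
       end)].
End Ext.

Definition has_grade (dM : nat) (actM : Sn -> Sn -> 'M[F]_dM) (k : nat) : Prop :=
  Ext_nonzero actM reg_act k /\ forall i, (i < k)%N -> ~ Ext_nonzero actM reg_act i.

End Sn.

(* Main.v *)
Require Import Defs.
From HB Require Import structures.
From mathcomp Require Import all_boot all_order all_algebra all_fingroup.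
From mathcomp Require Import zify.
Set Implicit Arguments. Unset Strict Implicit. Unset Printing Implicit Defensive.

(** Let w be a reduced word of v, a word without repeated letters. The elements
    below v are the products x_S of subwords, so [e, v] is a Boolean lattice.
    As a module, A is the sum over all a of the A e_a, and A e_a has one copy of
    the field at each b <= a; the bar complex then computes Ext^i(L_v, A e_a) as
    the cohomology of the order complex of {x < v} relative to
    U_a = {x < v | x is not <= a}. Since {x < v} has a least element, only the
    reduced cohomology of U_a in degree i - 2 is left (for v <> e).

    The rank criterion shows that x_S <= a iff x_I <= a for all monotone
    intervals I of S: intervals of letters in increasing, or in decreasing, order
    in the word. So U_a is the upper set generated by monotone intervals. Cut the
    support of v greedily into k monotone intervals, the chains; their first
    letters form an antichain of the heap of v, that is, no monotone interval
    contains two of them. Hence fewer than k generators of U_a never have join v,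
    and Mayer-Vietoris shows that the groups Ext^i vanish for i < k. For i = k
    one exhibits a for which U_a is generated by the k chains: U_a is then
    homotopy equivalent to the boundary of a (k-1)-simplex.

    On the other side, each chain moves one point past all the others it meets,
    and removing these k points leaves an increasing sequence, while the first
    letters of the chains give k disjoint inversions. So v has shape (n - k, k),
    and a longest element of a parabolic subgroup has this shape iff it is a
    product of k commuting simple reflections. *)

(** * Words in the adjacent transpositions *)

Definition adj_swap (l x : nat) : nat :=
  if x == l then l.+1 else if x == l.+1 then l else x.
(** Letters act from left to right, like the factors of a product in [{perm 'I_n}], but on all of
    [nat], which spares bounds on the letters. *)
Definition act_word (w : seq nat) (p : nat) : nat := foldl (fun x l => adj_swap l x) p w.

Arguments act_word : simpl never.

Lemma act_word_cat w1 w2 p : act_word (w1 ++ w2) p = act_word w2 (act_word w1 p).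
Proof. by rewrite /act_word foldl_cat. Qed.

Lemma act_word_cons l w p : act_word (l :: w) p = act_word w (adj_swap l p).
Proof. by []. Qed.

Lemma adj_swapK l : involutive (adj_swap l).
Proof. by rewrite /adj_swap => x; do !case: eqP => //=; lia. Qed.

Lemma act_wordK w : cancel (act_word w) (act_word (rev w)).
Proof.
elim: w => [//|l w IH] p; rewrite rev_cons -cats1 act_word_cat act_word_cons IH.
by rewrite /act_word /= adj_swapK.
Qed.

Lemma act_wordVK w : cancel (act_word (rev w)) (act_word w).
Proof. by move=> p; rewrite -{1}[w]revK act_wordK. Qed.

Lemma act_word_inj w : injective (act_word w).
Proof. exact: can_inj (act_wordK w). Qed.

(** The letter [i] is the only one that moves a point across the gap between [i] and [i.+1]. *)
Lemma act_word_le w i p : i \notin w -> (act_word w p <= i) = (p <= i).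
Proof.
elim: w p => [//|l w IH] p; rewrite inE negb_or => /andP[nil niw].
rewrite act_word_cons IH // /adj_swap; do !case: eqP => //; lia.
Qed.

Lemma act_word_gt w i p : i \notin w -> (i < act_word w p) = (i < p).
Proof. by move=> niw; rewrite !ltnNge act_word_le. Qed.

Lemma act_word_bound w m p : all (fun l => l < m) w -> (act_word w p <= m) = (p <= m).
Proof.
by move=> /allP wm; apply: act_word_le; apply/negP => /wm; rewrite ltnn.
Qed.

Lemma act_word_fix w m p : all (fun l => l < m) w -> m < p -> act_word w p = p.
Proof.
elim: w p => [//|l w IH] p /= /andP[lm wm] mp; rewrite act_word_cons IH //.
  by rewrite /adj_swap; do !case: eqP => //; lia.
by rewrite /adj_swap; do !case: eqP => //; lia.
Qed.

(** The letter [i] occurs at most once, and the only point it lifts is the one that stands at [i] at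
    that moment. *)
Lemma crossing_unique w i p q : uniq w -> p <= i -> q <= i ->
  i < act_word w p -> i < act_word w q -> p = q.
Proof.
move=> uw pi qi; case: (boolP (i \in w)) => [iw|niw]; last by rewrite !act_word_gt //; lia.
case/splitPr: w / iw uw => w1 w2.
rewrite cat_uniq => /and3P[_ /norP[niw1 _]] /= /andP[niw2 _].
have key r : r <= i -> i < act_word (w1 ++ i :: w2) r -> act_word w1 r = i.
  move=> ri; rewrite act_word_cat act_word_cons act_word_gt //.
  have := ri; rewrite -(act_word_le _ niw1) /adj_swap; do !case: eqP => //; lia.
move=> /key-/(_ pi) hp /key-/(_ qi) hq.
by apply: (@act_word_inj w1); rewrite hp hq.
Qed.

Definition ascending (w : seq nat) (i j : nat) : Prop :=
  (forall l, i <= l < j -> l \in w) /\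
  (forall l, i <= l -> l.+1 < j -> index l w < index l.+1 w).

(** A climbing point crosses every gap in between, and it must have crossed gap [l] before it can
    cross gap [l.+1]. *)
Lemma crossing_ascending w i j p : uniq w -> p <= i -> j <= act_word w p ->
  ascending w i j.
Proof.
move=> uw pi jp.
have inw l : i <= l < j -> l \in w.
  move=> lij; apply/negPn/negP => lw; have := act_word_le p lw; lia.
split=> // l il lj; have lw1 : l.+1 \in w by apply: inw; lia.
move: uw jp; case/splitPr: w / lw1 inw => w1 w2 _.
rewrite cat_uniq => /and3P[_ /norP[lw1 _]] /= /andP[lw2 _] jp.
rewrite !index_cat (negbTE lw1) /= eqxx addn0.
case: ifP => [|lw1']; first by rewrite index_mem.
move: jp; rewrite act_word_cat act_word_cons.
have := act_word_le p (negbT lw1').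
have := act_word_le (adj_swap l.+1 (act_word w1 p)) lw2.
rewrite /adj_swap; do !case: eqP; lia.
Qed.

(** The letters before [j] contain the shorter ascending interval and by induction bring a point to
    [j]; the letter [j] lifts it to [j.+1], and nothing brings it back below. *)
Lemma ascending_crossing w i j : uniq w -> i < j -> ascending w i j ->
  exists2 p, p <= i & j <= act_word w p.
Proof.
elim: j w => [//|j IH] w uw; rewrite ltnS => ij [inw idx].
have jw : j \in w by apply: inw; lia.
case/splitPr: w / jw uw inw idx => w1 w2 uw inw idx.
have := uw; rewrite cat_uniq => /and3P[uw1 /norP[jw1 _]] /= /andP[jw2 _].
have fin p : p <= i -> act_word w1 p = j -> exists2 p, p <= i & j < act_word (w1 ++ j :: w2) p.
  move=> pi hp; exists p => //.
  by rewrite act_word_cat act_word_cons hp /adj_swap eqxx act_word_gt.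
move: ij; rewrite leq_eqVlt => /orP[/eqP eij|ij].
  apply: (fin (act_word (rev w1) j)); last exact: act_wordVK.
  by rewrite act_word_le ?mem_rev ?eij.
have idj : index j (w1 ++ j :: w2) = size w1.
  by rewrite index_cat (negbTE jw1) /= eqxx addn0.
have inw1 l : i <= l < j -> l \in w1.
  move=> /andP[il lj].
  have mono d : l + d.+1 <= j -> index l (w1 ++ j :: w2) < index (l + d.+1) (w1 ++ j :: w2).
    elim: d => [|d IHd] ldj; first by rewrite addn1; apply: idx; lia.
    by apply: ltn_trans (IHd _) _; rewrite ?[l + d.+2]addnS; [lia|apply: idx; lia].
  have := mono (j - l.+1); rewrite (_ : l + _ = j) ?idj; last lia.
  move=> /(_ (leqnn _)).
  by rewrite index_cat; case: ifP => //; lia.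
have [] := IH w1 uw1 ij.
  split=> // l il lj; have := idx l il (ltnW lj).
  by rewrite !index_cat !inw1 //; lia.
move=> p pi jp; apply: (fin p) => //.
by apply/eqP; rewrite eqn_leq jp act_word_le //; lia.
Qed.

Lemma index_subseq2 (w : seq nat) y z : uniq w ->
  subseq [:: y; z] w = (index y w < index z w < size w).
Proof.
elim: w => [//|x w IH] /= /andP[xw uw].
rewrite [x == y]eq_sym [x == z]eq_sym; case: (y =P x) => [yx|_].
  rewrite sub1seq -index_mem; case: (z =P x) => [zx|_] /=.
    by rewrite zx index_mem (negbTE xw).
  by rewrite ltnS.
rewrite IH //; case: (z =P x) => [->|_]; last by rewrite !ltnS.
by move: xw; rewrite -index_mem => /negbTE->; rewrite andbF.
Qed.

Lemma ascending_filter w (S : pred nat) i j : uniq w ->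
  ascending (filter S w) i j <->
  (forall l, i <= l < j -> S l) /\ ascending w i j.
Proof.
move=> uw; have uf := filter_uniq S uw; split.
  move=> [inw idx]; split.
    by move=> l /inw; rewrite mem_filter => /andP[].
  split; first by move=> l /inw; rewrite mem_filter => /andP[].
  move=> l il lj; have := idx l il lj.
  have h : l.+1 \in filter S w by apply: inw; lia.
  have := index_subseq2 l l.+1 uf; rewrite [index l.+1 _ < size _]index_mem h andbT => <-.
  by rewrite subseq_filter index_subseq2 // => /andP[_ /andP[]].
move=> [hS [inw idx]].
have inf l : i <= l < j -> l \in filter S w by move=> lij; rewrite mem_filter hS ?inw.
split=> // l il lj; have := idx l il lj.
have h : l.+1 \in w by apply: inw; lia.
have := index_subseq2 l l.+1 uw; rewrite [index l.+1 _ < size _]index_mem h andbT => <- sub.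
have : subseq [:: l; l.+1] (filter S w).
  by rewrite subseq_filter sub /= !hS //; lia.
by rewrite index_subseq2 // => /andP[].
Qed.

(** * Words as permutations, inversions and Bruhat steps *)

Section Bruhat.
Variable N : nat.
Notation Sn := {perm 'I_N.+1}.
Implicit Types (u v w x a : Sn) (p q r : 'I_N.+1) (s : seq nat).

Definition word_perm s : Sn := word_prod [seq inord l | l <- s].

Lemma val_sigma l p : l < N -> sigma (inord l) p = adj_swap l p :> nat.
Proof.
move=> lN; have h1 : (inord l : 'I_N.+1) = l :> nat by rewrite inordK //; lia.
have h2 : insubd (inord l : 'I_N.+1) (inord l : 'I_N.+1).+1 = l.+1 :> nat.
  by rewrite val_insubd h1 ltnS lN.
rewrite /sigma permE /= /adj_swap -!val_eqE /= h2 h1.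
by rewrite h1 in h2; do !case: eqP => _ //=; rewrite h1.
Qed.

Lemma word_perm_cons l s : word_perm (l :: s) = (sigma (inord l) * word_perm s)%g.
Proof. by rewrite /word_perm /word_prod /= big_cons. Qed.

Lemma word_permE s p : all (fun l => l < N) s -> word_perm s p = act_word s p :> nat.
Proof.
elim: s p => [|l s IH] p /=; first by rewrite /word_perm /word_prod big_nil perm1.
by move=> /andP[lN sN]; rewrite word_perm_cons permM IH // val_sigma.
Qed.

Lemma word_perm_rev s : all (fun l => l < N) s -> word_perm (rev s) = (word_perm s)^-1%g.
Proof.
move=> sN; apply/permP=> p; apply: (can_inj (permK (word_perm s))).
by rewrite permKV; apply/val_inj; rewrite /= !word_permE ?all_rev // act_wordVK.
Qed.

Lemma sigma_tperm l : l < N -> sigma (inord l) = tperm (inord l) (inord l.+1) :> Sn.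
Proof.
move=> lN; apply/permP => r; apply/val_inj; rewrite /= val_sigma // permE /= -!val_eqE /=.
have -> : (inord l : 'I_N.+1) = l :> nat by rewrite inordK //; apply: ltnW.
have e : (inord l.+1 : 'I_N.+1) = l.+1 :> nat by rewrite inordK.
by rewrite e /adj_swap; do !case: eqP => //= _; rewrite ?e // inordK //; apply: ltnW.
Qed.

Definition inversions w := [set ij : 'I_N.+1 * 'I_N.+1 | (ij.1 < ij.2) && (w ij.2 < w ij.1)].

Lemma coxlenE w : coxlen w = #|inversions w|. Proof. by []. Qed.

Lemma tperm_val p q r : tperm p q r =
  (if r == p :> nat then q : nat else if r == q :> nat then p else r) :> nat.
Proof. by rewrite permE /= -!val_eqE /=; do !case: ifP. Qed.

(* Transporting an inversion by the transposition, unless that reverses it,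
   injects the inversions of u into those of the longer permutation. *)
Lemma coxlen_tperm u p q : p < q -> u p < u q -> coxlen u < coxlen (tperm p q * u)%g.
Proof.
move=> pq upq; set w := (_ * u)%g.
have wE r : w r = u (tperm p q r) by rewrite permM.
have wp : w p = u q by rewrite wE tpermL.
have wq : w q = u p by rewrite wE tpermR.
have wo r : r != p -> r != q -> w r = u r.
  by move=> rp rq; rewrite wE tpermD // eq_sym.
pose t := tperm p q.
pose f (ij : 'I_N.+1 * 'I_N.+1) := if t ij.1 < t ij.2 then (t ij.1, t ij.2) else ij.
have pqw : (p, q) \in inversions w by rewrite inE /= wp wq pq.
rewrite !coxlenE (cardsD1 (p, q) (inversions w)) pqw add1n ltnS.
have cond ij : ij \in inversions u -> ~~ (t ij.1 < t ij.2) ->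
    (ij.1 = p /\ ij.2 < q) \/ (ij.2 = q /\ p < ij.1).
  case: ij => i j; rewrite inE /= => /andP[ij uij]; rewrite /t !tperm_val -leqNgt.
  do !(case: eqP => [/val_inj ?|?]); move=> ?; subst; try lia.
  - by right; split=> //; lia.
  - by left; split=> //; lia.
have finj : {in inversions u &, injective f}.
  move=> [i j] [i' j'] iu iu' /=; rewrite /f /=.
  case: ifP => c; case: ifP => c' //.
  - by case=> /perm_inj -> /perm_inj ->.
  - case=> ti tj; move: c'; rewrite -ti -tj /t !tpermK.
    by move: iu; rewrite inE /= => /andP[->].
  - case=> ti tj; move: c; rewrite ti tj /t !tpermK.
    by move: iu'; rewrite inE /= => /andP[->].
rewrite -(card_in_imset finj); apply/subset_leq_card/subsetP => _ /imsetP[ij iu ->].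
rewrite in_setD1 /f; case: ifP => c.
  move: (iu); rewrite !inE /= => /andP[lij uij].
  rewrite c !wE /t !tpermK uij !andbT.
  apply/eqP => [[h1 h2]].
  have e1 : ij.1 = q by rewrite -[ij.1](tpermK p q) -/t h1 /t tpermL.
  have e2 : ij.2 = p by rewrite -[ij.2](tpermK p q) -/t h2 /t tpermR.
  by move: lij; rewrite e1 e2; lia.
have := cond ij iu (negbT c); case: ij iu c => i j; rewrite !inE /= => /andP[ij uij] c.
case=> [[e1 e2]|[e1 e2]]; subst.
  rewrite xpair_eqE eqxx /= -val_eqE /= ij wp wo -?val_eqE /=; try lia.
rewrite xpair_eqE eqxx andbT -val_eqE /= ij wq wo -?val_eqE /=; try lia.
Qed.

Lemma coxlen_lt_tperm u p q : p < q ->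
  (coxlen u < coxlen (tperm p q * u)%g) = (u p < u q).
Proof.
move=> pq; case: (ltnP (u p)) => [upq|uqp]; first by apply: coxlen_tperm.
apply/negbTE; rewrite -leqNgt ltnW //.
rewrite -{2}[u](tpermKg p q); apply: coxlen_tperm => //.
rewrite !permM tpermL tpermR ltn_neqAle uqp andbT.
by apply/eqP => /val_inj/perm_inj e; move: pq; rewrite e ltnn.
Qed.

(** A factor [tperm i j] on the right exchanges two values; it is rewritten as a factor on the left,
    exchanging the positions that hold them. The length grows exactly when the values at these
    positions were in order. *)
Lemma bruhat_stepP u w :
  reflect (exists p q, [/\ p < q, u p < u q & w = (tperm p q * u)%g]) (bruhat_step u w).
Proof.
apply: (iffP idP).
  case/andP=> /existsP[i /existsP[j /andP[ij /eqP we]]] len.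
  have ee : w = (tperm ((u^-1)%g i) ((u^-1)%g j) * u)%g.
    by rewrite we -tpermJ conjgE invgK mulgA mulgKV.
  have nij : (u^-1)%g i != (u^-1)%g j by rewrite (inj_eq perm_inj).
  case: (ltngtP ((u^-1)%g i) ((u^-1)%g j)) => h.
  - by exists ((u^-1)%g i), ((u^-1)%g j); split; rewrite // -coxlen_lt_tperm // -ee.
  - exists ((u^-1)%g j), ((u^-1)%g i); split=> //; last by rewrite tpermC.
    by rewrite -coxlen_lt_tperm // tpermC -ee.
  - by move/eqP: nij; case; apply/val_inj.
move=> [p [q [pq upq ->]]]; apply/andP; split; last by apply: coxlen_tperm.
apply/existsP; exists (u p); apply/existsP; exists (u q).
rewrite (inj_eq perm_inj) -val_eqE /= neq_ltn pq -tpermJ /conjg !mulgA mulgV mul1g.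
exact: eqxx.
Qed.

End Bruhat.

(** * Rank criterion for the Bruhat order *)

Section Bruhat2.
Variable N : nat.
Notation Sn := {perm 'I_N.+1}.
Implicit Types (u v w x a : Sn) (p q r : 'I_N.+1) (s : seq nat).

(** The number of dots of the permutation matrix of [w] in a corner rectangle. *)
Definition bruhat_rank w i j := #|[set p : 'I_N.+1 | (p <= i) && (j <= w p)]|.

Lemma bruhat_rank_split w i j k : j <= k ->
  bruhat_rank w i j = bruhat_rank w i k + #|[set p : 'I_N.+1 | (p <= i) && (j <= w p < k)]|.
Proof.
move=> jk; rewrite /bruhat_rank -cardsUI.
rewrite (_ : _ :&: _ = set0) ?cards0 ?addn0; last first.
  by apply/setP=> p; rewrite !inE; lia.
by apply: eq_card => p; rewrite !inE; lia.
Qed.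

Lemma coxlen_max w : coxlen w <= #|{: 'I_N.+1 * 'I_N.+1}|.
Proof. exact: max_card. Qed.

(** The length of [u] is raised step by step: at the first position where [u] and [w] differ, the
    value of [u] is exchanged with a later, larger one, chosen such that the ranks stay bounded by
    those of [w]. *)
Lemma rank_bruhat u w : (forall i j, bruhat_rank u i j <= bruhat_rank w i j) -> bruhat_le u w.
Proof.
move: {2}(_ - coxlen u).+1 (ltnSn (#|{: 'I_N.+1 * 'I_N.+1}| - coxlen u)) => m.
elim: m u => // m IH u um rkuw.
case: (u =P w) => [->|uw]; first exact: connect0.
have [i0 ui0] : exists i0, u i0 != w i0.
  apply/existsP; rewrite -negb_forall; apply/negP => /forallP h.
  by apply: uw; apply/permP => p; apply/eqP; apply: h.
case: (@arg_minnP _ i0 (fun i => u i != w i) (@nat_of_ord _) ui0) => i uwi imin.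
have below p : p < i -> u p = w p.
  move=> pi; apply/eqP; apply/negPn/negP => /imin; lia.
(* Otherwise [u] would have more dots than [w] in the corner given by [i] and [u i]. *)
have ui : u i < w i.
  rewrite ltn_neqAle uwi /= leqNgt; apply/negP => wi.
  have := rkuw i (u i); rewrite leqNgt => /negP; apply; apply: proper_card.
  apply/properP; split.
    apply/subsetP => p; rewrite !inE => /andP[pi hp]; rewrite pi /=.
    by have [e|/below->//] : p = i \/ p < i; [|rewrite e in hp; lia]; 
       move: pi; rewrite leq_eqVlt => /orP[/eqP/val_inj->|]; [left|right].
  by exists i; rewrite !inE leqnn ?leqnn //= -ltnNge.
(* The partner of [i] is the first later position with a value above [u i] and at most [w i]. The
   position where [u] takes the value [w i] shows that there is one. *)
pose Q := fun q : 'I_N.+1 => (i < q) && (u i < u q <= w i).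
have [q0 Qq0] : exists q0, Q q0.
  exists ((u^-1)%g (w i)); rewrite /Q permKV ui leqnn !andbT ltnNge leq_eqVlt.
  apply/negP => /orP[/eqP/val_inj e|h].
    by case/negP: uwi; rewrite -[X in u X]e permKV.
  have := below _ h; rewrite permKV => /perm_inj e; move: h; rewrite -e; lia.
case: (@arg_minnP _ q0 Q (@nat_of_ord _) Qq0) => j /andP[ij /andP[uij ujw]] jmin.
have st : bruhat_step u (tperm i j * u)%g by apply/bruhat_stepP; exists i, j.
apply: connect_trans (connect1 st) _; apply: IH.
  have h := coxlen_tperm ij uij; have h' := coxlen_max (tperm i j * u)%g.
  by apply: leq_trans (ltn_sub2l (leq_trans h h') h) _.
move=> x y; set u' := (_ * u)%g.
have u'i : u' i = u j by rewrite permM tpermL.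
have u'o p : p <> i :> nat -> p <> j :> nat -> u' p = u p.
  by move=> /eqP pi /eqP pj; rewrite permM tpermD // eq_sym.
have [xj|jx] := leqP j x.
  apply: leq_trans (rkuw x y); rewrite /bruhat_rank.
  rewrite -(card_imset _ (@perm_inj _ (tperm i j))); apply/subset_leq_card/subsetP.
  move=> _ /imsetP[p pS ->]; move: pS; rewrite !inE permM => /andP[px yp]; rewrite yp andbT.
  by rewrite tperm_val; do !case: eqP => ?; lia.
have [xi|ix] := leqP i x; last first.
  apply: leq_trans (rkuw x y); apply/subset_leq_card/subsetP => p.
  by rewrite !inE => /andP[px yp]; rewrite -u'o ?px ?yp //; lia.
have [yj|jy] := boolP (u i < y <= u j); last first.
  apply: leq_trans (rkuw x y); apply/subset_leq_card/subsetP => p.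
  rewrite !inE => /andP[px yp]; rewrite px /=.
  case: (p =P i) yp => [->|/eqP pi]; first by rewrite u'i; lia.
  by rewrite u'o //; [apply/eqP|lia].
(* In this box the rank of [u] may grow by one. Above the value [w i] the hypothesis suffices.
   Between [y] and [w i], by the choice of [j], all dots of [u] are also dots of [w], and [w] has
   the one at [i] in addition. *)
have ywi : y <= (w i).+1 by lia.
rewrite (bruhat_rank_split w _ ywi); apply: leq_trans (leq_add (rkuw _ _) (leqnn _)).
have : bruhat_rank u' x y <= (bruhat_rank u x y).+1.
  apply: (@leq_trans #|i |: [set p : 'I_N.+1 | (p <= x) && (y <= u p)]|); last first.
    by rewrite cardsU1; apply: leq_add (leq_b1 _) (leqnn _).
  apply/subset_leq_card/subsetP => p; rewrite !inE => /andP[px yp].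
  by case: (p =P i) => //= /eqP pi; rewrite px /= -u'o //; [apply/eqP|lia].
move=> /leq_trans; apply; rewrite (bruhat_rank_split u _ ywi) -addnS leq_add2l.
pose S := [set p : 'I_N.+1 | (p <= x) && (y <= u p < (w i).+1)].
rewrite -/S; have <- : #|i |: S| = #|S|.+1.
  have iS : i \notin S by rewrite inE; lia.
  by rewrite cardsU1 iS.
apply/subset_leq_card/subsetP => p; rewrite !inE => /orP[/eqP->|/andP[px yp]].
  by rewrite xi; lia.
rewrite px /=; case: (ltngtP p i) => [pi|ip|/val_inj e].
- by rewrite -below.
- by have := jmin p; rewrite /Q; lia.
- by move: yp; rewrite e; lia.
Qed.

Definition up w i j := [exists p : 'I_N.+1, (p <= i) && (j <= w p)].
Definition down w i j := [exists p : 'I_N.+1, (j <= p) && (w p <= i)].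

(** A Bruhat step brings the larger of two values to the earlier position, so a witness lost at [q]
    is replaced by [p]. *)
Lemma up_bruhat u w i j : bruhat_le u w -> up u i j -> up w i j.
Proof.
case/connectP=> s; elim: s u => [u _ -> //|x s IH] u /= /andP[/bruhat_stepP[p [q [pq upq ->]]] sx] e.
move=> /existsP[r /andP[ri jr]]; apply: (IH _ sx e); apply/existsP.
case: (leqP j ((tperm p q * u)%g r)) => h; first by exists r; rewrite ri.
move: h; rewrite permM; case: tpermP => [e1|e1|_ _] h; last by rewrite ltnNge jr in h.
  by rewrite e1 in jr; rewrite ltnNge (leq_trans jr (ltnW upq)) in h.
rewrite e1 in ri jr; by exists p; rewrite permM tpermL; lia.
Qed.

Lemma down_bruhat u w i j : bruhat_le u w -> down u i j -> down w i j.
Proof.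
case/connectP=> s; elim: s u => [u _ -> //|x s IH] u /= /andP[/bruhat_stepP[p [q [pq upq ->]]] sx] e.
move=> /existsP[r /andP[ri jr]]; apply: (IH _ sx e); apply/existsP.
case: (leqP ((tperm p q * u)%g r) i) => h; first by exists r; rewrite ri.
move: h; rewrite permM; case: tpermP => [e1|e1|_ _] h; last by rewrite ltnNge jr in h.
  rewrite e1 in ri jr; by exists q; rewrite permM tpermR; lia.
by rewrite e1 in jr; rewrite ltnNge (leq_trans (ltnW upq) jr) in h.
Qed.

Lemma bruhat_le_coxlen u w : bruhat_le u w -> u = w \/ coxlen u < coxlen w.
Proof.
case/connectP=> s; elim: s u => [|x s IH] u /=; first by move=> _ ->; left.
move=> /andP[/andP[_ ux] sx] e; right.
by case: (IH _ sx e) => [<-//|h]; apply: ltn_trans ux h.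
Qed.

Lemma bruhat_lt_trans : transitive (@bruhat_lt N.+1).
Proof.
move=> y x z /andP[xy lxy] /andP[yz lyz]; apply/andP; split; last exact: connect_trans lyz.
case: (bruhat_le_coxlen lxy) => [e|h1]; first by rewrite e eqxx in xy.
case: (bruhat_le_coxlen lyz) => [e|h2]; first by rewrite e eqxx in yz.
by apply/eqP => e; rewrite e in h1; lia.
Qed.

Lemma bruhat_lt_irr : irreflexive (@bruhat_lt N.+1).
Proof. by move=> x; rewrite /bruhat_lt eqxx. Qed.

End Bruhat2.

(** * Boolean permutations and their subwords *)

(** The strong exchange condition: two points that end in reversed order are at some moment
    neighbours interchanged by a letter. Deleting this letter amounts to composing with the
    transposition of [p] and [q]. *)
Lemma exchange s p q : p < q -> act_word s q < act_word s p ->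
  exists s1 l s2, [/\ s = s1 ++ l :: s2, act_word s1 p = l & act_word s1 q = l.+1].
Proof.
elim: s p q => [|l s IH] p q pq; first by rewrite /act_word /=; lia.
rewrite !act_word_cons => h.
case: (boolP ((p == l) && (q == l.+1))) => [/andP[/eqP-> /eqP->]|c].
  by exists [::], l, s.
have [|s1 [k [s2 [-> e1 e2]]]] := IH (adj_swap l p) (adj_swap l q) _ h.
  by move: c pq; rewrite /adj_swap; do !case: eqP; lia.
by exists (l :: s1), k, s2.
Qed.

(** The interchanging letter [l] occurs only once, so the gap [l] is crossed neither before nor
    after it. *)
Lemma inversion_letter s p q : uniq s -> p < q -> act_word s q < act_word s p ->
  exists l, [/\ l \in s, p <= l < q & act_word s q <= l < act_word s p].
Proof.
move=> us pq /(exchange pq)[s1 [l [s2 [e e1 e2]]]].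
move: us; rewrite e cat_uniq => /and3P[_ /norP[l1 _]] /= /andP[l2 _].
exists l; rewrite mem_cat inE eqxx orbT !act_word_cat !act_word_cons e1 e2.
rewrite act_word_le // act_word_gt // -(act_word_le p l1) -(act_word_gt q l1) e1 e2.
by rewrite leqnn ltnSn /adj_swap !eqxx; case: eqP => [|_]; split=> //; lia.
Qed.

Section Boolean.
Variable N : nat.
Notation Sn := {perm 'I_N.+1}.
Implicit Types (u v x a : Sn) (p q r : 'I_N.+1) (s w : seq nat) (S : pred nat).

Lemma down_inv u i j : down u i j = up (u^-1)%g i j.
Proof.
apply/existsP/existsP => -[p /andP[pi pj]].
  by exists (u p); rewrite permK pi pj.
by exists ((u^-1)%g p); rewrite permKV pi pj.
Qed.

Lemma up_word_perm s i j : all (fun l => l < N) s -> uniq s -> i < j ->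
  up (word_perm N s) i j <-> ascending s i j.
Proof.
move=> sN us ij; split.
  by case/existsP=> p /andP[pi]; rewrite word_permE //; apply: crossing_ascending.
case/(ascending_crossing us ij) => p pi jp.
have pN : p < N.+1.
  by rewrite ltnNge; apply/negP => /(act_word_fix sN) e; move: jp; rewrite e; lia.
by apply/existsP; exists (Ordinal pN); rewrite word_permE //= pi.
Qed.

Lemma down_word_perm s i j : all (fun l => l < N) s -> uniq s -> i < j ->
  down (word_perm N s) i j <-> ascending (rev s) i j.
Proof.
by move=> sN us ij; rewrite down_inv -word_perm_rev // up_word_perm ?all_rev ?rev_uniq.
Qed.

Definition bruhat_corank u i j := #|[set p : 'I_N.+1 | (j <= p) && (u p <= i)]|.

(** Both sides count the points with [p <= i] or [u p <= j]. *)
Lemma bruhat_rank_corank u i j : bruhat_rank u i j.+1 + #|[set p : 'I_N.+1 | p <= j]| =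
  #|[set p : 'I_N.+1| p <= i]| + bruhat_corank u j i.+1.
Proof.
rewrite -(card_preimset _ (@perm_inj _ u)) /bruhat_rank /bruhat_corank.
rewrite -(cardsID [set p : 'I_N.+1 | p <= i] (_ @^-1: _)) addnA; congr (_ + _); last first.
  by apply: eq_card => p; rewrite !inE; lia.
rewrite -(cardsID [set p : 'I_N.+1 | j < u p] [set p : 'I_N.+1 | p <= i]); congr (_ + _).
  by apply: eq_card => p; rewrite !inE; lia.
by apply: eq_card => p; rewrite !inE; lia.
Qed.

Lemma bruhat_rank_le1 s i j : all (fun l => l < N) s -> uniq s -> i < j -> bruhat_rank (word_perm N s) i j <= 1.
Proof.
move=> sN us ij; apply/card_le1_eqP => p q; rewrite !inE !word_permE //.
move=> /andP[pi jp] /andP[qi jq]; apply/val_inj => /=.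
by apply: (crossing_unique us qi pi _ _) => //; apply: leq_trans ij _.
Qed.

Lemma bruhat_corank_inv u i j : bruhat_corank u i j = bruhat_rank (u^-1)%g i j.
Proof.
rewrite /bruhat_rank /bruhat_corank -[RHS](card_preimset _ (@perm_inj _ u)); apply: eq_card => p.
by rewrite !inE permK andbC.
Qed.

(** Above the diagonal the ranks of a word without repetitions are 0 or 1, so the rank criterion
    only asks for witnesses of crossings. *)
Lemma boolean_bruhat s a : all (fun l => l < N) s -> uniq s ->
  (forall i j, i < j -> up (word_perm N s) i j -> up a i j) ->
  (forall i j, i < j -> down (word_perm N s) i j -> down a i j) ->
  bruhat_le (word_perm N s) a.
Proof.
move=> sN us hup hdown; apply: rank_bruhat => i j.
have gen b i' j' : bruhat_rank b i' j' <= 1 -> forall c, (up b i' j' -> up c i' j') ->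
    bruhat_rank b i' j' <= bruhat_rank c i' j'.
  move=> b1 c bc; case: (posnP (bruhat_rank b i' j')) => [-> //|b0].
  apply: leq_trans b1 _; case/card_gt0P: b0 => p; rewrite inE => hp.
  have /bc/existsP[q hq] : up b i' j' by apply/existsP; exists p.
  by apply/card_gt0P; exists q; rewrite inE.
have [ij|] := ltnP i j; first by apply: gen; [apply: bruhat_rank_le1|apply: hup].
case: j => [_|j ji].
  by rewrite /bruhat_rank (eq_card (B := [set p : 'I_N.+1 | (p <= i) && (0 <= a p)])) // => p; rewrite !inE.
(* On and below the diagonal, ranks are traded for coranks, which are ranks of the inverse above the
   diagonal; the inverse is given by the reversed word. *)
rewrite -(leq_add2r #|[set p : 'I_N.+1 | p <= j]|) !bruhat_rank_corank leq_add2l !bruhat_corank_inv.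
have ji' : j < i.+1 by apply: ltnW.
apply: gen; first by rewrite -word_perm_rev // bruhat_rank_le1 ?all_rev ?rev_uniq.
by rewrite -!down_inv; apply: hdown.
Qed.

Section Word.
Variables (w : seq nat).
Hypotheses (wN : all (fun l => l < N) w) (uw : uniq w).

(** Any predicate may serve as a set of letters; only its values on the letters of [w] matter. *)
Definition sub_perm S : Sn := word_perm N (filter S w).

Lemma all_filterN S : all (fun l => l < N) (filter S w).
Proof. by apply/allP => l; rewrite mem_filter => /andP[_ /(allP wN)]. Qed.

Lemma up_sub_perm S i j : i < j ->
  up (sub_perm S) i j <-> (forall l, i <= l < j -> S l) /\ ascending w i j.
Proof.
by move=> ij; rewrite up_word_perm ?all_filterN ?filter_uniq // ascending_filter.
Qed.

Lemma down_sub_perm S i j : i < j ->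
  down (sub_perm S) i j <-> (forall l, i <= l < j -> S l) /\ ascending (rev w) i j.
Proof.
move=> ij; rewrite down_word_perm ?all_filterN ?filter_uniq //.
by rewrite -filter_rev ascending_filter ?rev_uniq.
Qed.

Lemma sub_perm_bruhat S a :
  (forall i j, i < j -> (forall l, i <= l < j -> S l) -> ascending w i j -> up a i j) ->
  (forall i j, i < j -> (forall l, i <= l < j -> S l) -> ascending (rev w) i j -> down a i j) ->
  bruhat_le (sub_perm S) a.
Proof.
move=> h1 h2; apply: boolean_bruhat; rewrite ?all_filterN ?filter_uniq //.
  by move=> i j ij; rewrite -/(sub_perm S) up_sub_perm // => -[]; apply: h1.
by move=> i j ij; rewrite -/(sub_perm S) down_sub_perm // => -[]; apply: h2.
Qed.

Lemma sub_perm_mono S S' : (forall l, l \in w -> S l -> S' l) -> bruhat_le (sub_perm S) (sub_perm S').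
Proof.
move=> sub; apply: sub_perm_bruhat => i j ij hS h; [apply/up_sub_perm|apply/down_sub_perm] => //; split=> //.
  by move=> l lij; apply: sub (hS _ lij); apply: h.1.
by move=> l lij; apply: sub (hS _ lij); rewrite -mem_rev; apply: h.1.
Qed.

(** A crossing of the gap [l] detects the letter [l]. Together with [sub_perm_mono], this orders the
    subwords by inclusion of their letters. *)
Lemma sub_perm_le S S' : bruhat_le (sub_perm S) (sub_perm S') -> forall l, l \in w -> S l -> S' l.
Proof.
move=> le l lw Sl; have : up (sub_perm S) l l.+1.
  apply/up_sub_perm => //; split=> [k kl|]; first by rewrite (_ : k = l) //; lia.
  by split=> [k kl|]; [rewrite (_ : k = l) //; lia|lia].
by move/(up_bruhat le)/up_sub_perm => [//|h _]; apply: h; rewrite leqnn ltnS leqnn.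
Qed.

(** The subword property: by [exchange], a step down from a subword deletes one of its letters. *)
Lemma below_sub_perm u S : bruhat_le u (sub_perm S) -> exists S', u = sub_perm S'.
Proof.
case/connectP=> s; elim: s u => [|y s IH] u /=; first by move=> _ <-; exists S.
move=> /andP[/bruhat_stepP[p [q [pq upq ey]]] sy] e.
have [S1 e1] := IH y sy e; set f := filter S1 w.
have uf : uniq f by apply: filter_uniq.
have fN : all (fun l => l < N) f by apply: all_filterN.
have : act_word f q < act_word f p.
  by rewrite -!(word_permE (N := N)) // -/(sub_perm S1) -e1 ey !permM tpermL tpermR.
case/(exchange pq) => f1 [l [f2 [ef h1 h2]]].
exists (fun k => S1 k && (k != l)); apply: (mulgI (tperm p q)).
rewrite -ey e1; apply/permP => r; apply/val_inj => /=; rewrite permM.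
have ef' : [seq k <- w | S1 k && (k != l)] = f1 ++ f2.
  have -> : [seq k <- w | S1 k && (k != l)] = filter (predC1 l) f.
    by rewrite -filter_predI; apply: eq_filter => k /=; rewrite andbC.
  move: uf; rewrite ef cat_uniq filter_cat /= eqxx /=.
  move=> /and3P[_ /norP[l1 _] /andP[l2 _]].
  by congr (_ ++ _); apply/all_filterP/allP => k kf /=; apply/eqP => ek;
    [move: l1|move: l2]; rewrite -ek kf.
rewrite !word_permE ?all_filterN // ef' -/f ef !act_word_cat act_word_cons; congr (act_word f2 _).
rewrite tperm_val /adj_swap; case: (r =P p :> nat) => [->|rp].
  by rewrite h1 h2 eqxx.
case: (r =P q :> nat) => [->|rq]; first by rewrite h1 h2 eqxx; case: eqP => //; lia.
by rewrite -{1}h1 -h2 !(inj_eq (@act_word_inj f1)); do !case: eqP => //.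
Qed.
End Word.

Lemma inversion_descent u p q : p < q -> u q < u p ->
  exists j : nat, [/\ p <= j < q, j < N & u (inord j.+1) < u (inord j)].
Proof.
move=> pq upq; case: (pickP (fun j : 'I_N => (p <= j < q) && (u (inord j.+1) < u (inord j)))).
  by move=> j /andP[h1 h2]; exists j.
move=> nodesc; have mono d : p + d <= q -> u p <= u (inord (p + d)).
  elim: d => [|d IH] pd; first by rewrite addn0 inord_val.
  have pdN : p + d < N by have := ltn_ord q; lia.
  have := nodesc (Ordinal pdN); rewrite /= addnS; have := IH; lia.
have := mono (q - p); rewrite (_ : p + (q - p) = q) ?inord_val; lia.
Qed.

Lemma coxlen_descent u j : j < N -> u (inord j.+1) < u (inord j) ->
  coxlen u = (coxlen (sigma (inord j) * u)%g).+1.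
Proof.
move=> jN uj.
have jE : (inord j : 'I_N.+1) = j :> nat by rewrite inordK //; lia.
have j1E : (inord j.+1 : 'I_N.+1) = j.+1 :> nat by rewrite inordK.
rewrite sigma_tperm //; set t := tperm _ _; apply/eqP; rewrite eqn_leq; apply/andP; split; last first.
  have := @coxlen_tperm N (t * u)%g (inord j) (inord j.+1).
  by rewrite jE j1E tpermKg !permM tpermL tpermR; apply.
rewrite [coxlen u]coxlenE (cardsD1 (inord j, inord j.+1) (inversions u)) inE /= jE j1E ltnSn uj add1n ltnS.
pose f (ij : 'I_N.+1 * 'I_N.+1) := (t ij.1, t ij.2).
have finj : injective f by move=> [a b] [c d] [/perm_inj-> /perm_inj->].
rewrite -(card_imset _ finj); apply/subset_leq_card/subsetP => _ /imsetP[[a b] h ->].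
move: h; rewrite !inE xpair_eqE /= !permM !tpermK -!val_eqE /= jE j1E => /andP[h /andP[ab ->]].
rewrite andbT !tperm_val jE j1E; move: h; do !case: eqP => ? //=; lia.
Qed.

Lemma inversion_exists u : u != 1%g -> exists p q, p < q /\ u q < u p.
Proof.
move=> u1; have [i0 ui0] : exists i0, u i0 != i0.
  apply/existsP; rewrite -negb_forall; apply/negP => /forallP h.
  by case/negP: u1; apply/eqP/permP => p; rewrite perm1; apply/eqP.
case: (@arg_minnP _ i0 (fun i => u i != i) (@nat_of_ord _) ui0) => i ui imin.
have below p : p < i -> u p = p.
  by move=> pi; apply/eqP; apply/negPn/negP => /imin; lia.
exists i, ((u^-1)%g i); rewrite permKV; split; rewrite ltnNge leq_eqVlt; apply/negP.
  move=> /orP[/eqP/val_inj e|/below]; first by move: ui; rewrite -{1}e permKV eqxx.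
  by rewrite permKV => e; move: ui; rewrite {1}e permKV eqxx.
move=> /orP[/eqP/val_inj e|/below/perm_inj e]; first by rewrite e eqxx in ui.
by rewrite e eqxx in ui.
Qed.

Lemma reduced_word_exists u :
  exists s, [/\ all (fun l => l < N) s, word_perm N s = u & size s = coxlen u].
Proof.
move: {2}(coxlen u).+1 (ltnSn (coxlen u)) => m; elim: m u => // m IH u um.
case: (u =P 1%g) => [->|/eqP/inversion_exists[p [q [pq h]]]].
  exists [::]; split=> //; first by rewrite /word_perm /word_prod big_nil.
  apply/esym/eqP; rewrite cards_eq0; apply/eqP/setP=> ij; rewrite !inE !perm1; lia.
have [j [_ jN hj]] := inversion_descent pq h.
have e := coxlen_descent jN hj; have [|s [sN es zs]] := IH (sigma (inord j) * u)%g.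
  by move: um; rewrite e.
exists (j :: s); split; rewrite /= ?jN ?zs //.
by rewrite word_perm_cons es mulgA /sigma tperm2 mul1g.
Qed.

(** [boolean_perm] quantifies over reduced words, so one has to be exhibited before the absence of
    repetitions can be used. *)
Lemma boolean_word u : boolean_perm u ->
  exists w, [/\ all (fun l => l < N) w, uniq w & u = word_perm N w].
Proof.
move=> bu; have [s [sN es zs]] := reduced_word_exists u.
exists s; split=> //; have : uniq [seq (inord l : 'I_N.+1) | l <- s].
  apply: bu; split; last by rewrite size_map.
  rewrite /valid_word all_map; apply/allP => l /(allP sN) /= lN.
  by rewrite inordK ?ltnS //; apply: ltnW.
exact: map_uniq.
Qed.
End Boolean.

(** * Chains of letters *)

Section Chains.
Variable J : pred nat.

(* [o l] says that the letter l comes before l.+1 in the word. Maximal intervals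
   of letters are cut greedily, from the left, into intervals [s, e] on which o
   is constant: the chains. *)
Fixpoint chain_start (o : pred nat) (l : nat) : bool :=
  if l is m.+1 then ~~ J m || (~~ chain_start o m && (o m.-1 != o m)) else true.

(* Up to commutations, this is the product over all chains [s, e] of the words
   (s+1 ... e)(s ... e-1), reversed when the chain is descending; the words of
   two adjacent chains come in the order in which the word has their adjacent
   letters. It lies above every subword that misses a letter of each chain. *)
Fixpoint obstruction (o : pred nat) (l : nat) : seq nat :=
  if l is m.+1 then
    if ~~ J m || chain_start o m then obstruction o m else
    let b := if o m.-1 then [:: m; m.-1] else [:: m.-1; m] in
    if (if chain_start o m.-1 then o m.-2 else o m.-1)
    then obstruction o m ++ b else b ++ obstruction o m
  else [::].

Lemma chain_startS o m :
  chain_start o m.+1 = ~~ J m || (~~ chain_start o m && (o m.-1 != o m)).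
Proof. by []. Qed.

Lemma obstructionS o m : obstruction o m.+1 =
  if ~~ J m || chain_start o m then obstruction o m else
  let b := if o m.-1 then [:: m; m.-1] else [:: m.-1; m] in
  if (if chain_start o m.-1 then o m.-2 else o m.-1)
  then obstruction o m ++ b else b ++ obstruction o m.
Proof. by []. Qed.

Arguments chain_start : simpl never.
Arguments obstruction : simpl never.

(** Negating [o] corresponds to reversing the word. The chains stay the same and the obstruction
    word is reversed, so that it is enough to study ascending intervals. *)
Lemma chain_start_flip o l : chain_start (fun x => ~~ o x) l = chain_start o l.
Proof. by elim: l => // l IH; rewrite !chain_startS IH; case: (o l) (o l.-1) => [] []. Qed.

Lemma obstruction_flip o l : obstruction (fun x => ~~ o x) l = rev (obstruction o l).
Proof.
elim: l => // m IH; rewrite !obstructionS IH !chain_start_flip; case: ifP => // _.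
case: (chain_start o m.-1); case: (o m.-1); case: (o m.-2) => /=;
  by rewrite ?rev_cat ?rev_cons -?cats1 -?catA.
Qed.

Lemma obstruction_bound o l : all (fun x => x < l) (obstruction o l).
Proof.
elim: l => // m IH; rewrite obstructionS.
have IH' : all (fun x => x < m.+1) (obstruction o m).
  by apply: sub_all IH => x /= /ltnW.
case: ifP => // _; cbv zeta; set b := if o m.-1 then _ else _.
have bb : all (fun x => x < m.+1) b by rewrite /b; case: (o m.-1); apply/and3P; split=> //; lia.
by case: ifP => _; rewrite all_cat IH' bb.
Qed.

Definition monotone (o : pred nat) i j : Prop :=
  (forall l, i <= l < j -> J l) /\ (forall l, i <= l -> l.+1 < j -> o l).

(** An initial piece of a chain is allowed here; [complete] asks in addition that letters less than
    [l] cannot prolong it. *)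
Definition chain o s e : Prop :=
  [/\ s <= e, chain_start o s, (forall x, s <= x <= e -> J x) &
      forall x, s < x <= e -> ~~ chain_start o x].

Definition complete o l s e : Prop :=
  [/\ chain o s e, e < l & e.+1 = l \/ ~~ J e.+1 \/ chain_start o e.+1].

Lemma chain_exists o m : J m -> exists s, chain o s m.
Proof.
elim: m => [|m IH] Jm.
  by exists 0; split=> // x; [rewrite leqn0 => /eqP->|lia].
case st : (chain_start o m.+1).
  exists m.+1; split=> // x; last lia.
  by move=> /andP[h1 h2]; rewrite (_ : x = m.+1) //; lia.
have Jm' : J m by move: st; rewrite chain_startS; case: (J m).
have [s [sm hs hJ hn]] := IH Jm'; exists s; split; rewrite ?(leqW sm) // => x /andP[sx].
  by rewrite leq_eqVlt => /orP[/eqP-> //|xm]; apply: hJ; rewrite sx.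
by rewrite leq_eqVlt => /orP[/eqP->|xm]; rewrite ?st // hn // sx.
Qed.

Variable o : pred nat.
Notation st := (chain_start o).
Notation ob l := (act_word (obstruction o l)).

(** If neither [x.+1] nor [x.+2] starts a chain and [x.+1] is a letter, then [o x = o x.+1]. *)
Lemma chain_direction s e : chain o s e -> forall x, s <= x < e -> o x = o s.
Proof.
move=> [se sts sJ sn] x; elim: x => [|x IH] sx; first by rewrite (_ : s = 0) //; lia.
case: (s =P x.+1) => [-> //|sx'].
have := sn x.+2; rewrite chain_startS sJ /= ?negb_and ?negbK; last lia.
have -> : st x.+1 = false by apply/negbTE/sn; lia.
move=> /(_ _)/eqP <-; last lia.
by apply: IH; lia.
Qed.

Lemma obstruction_le l m p : l <= m -> (ob l p <= m) = (p <= m).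
Proof.
move=> lm; apply: act_word_bound; apply: sub_all (obstruction_bound o l) => x /= h.
exact: leq_trans lm.
Qed.

Lemma obstruction_fix l p : l < p -> ob l p = p.
Proof. exact/act_word_fix/obstruction_bound. Qed.

Lemma obstruction_step_id m : ~~ J m || st m -> obstruction o m.+1 = obstruction o m.
Proof. by move=> h; rewrite obstructionS h. Qed.


Lemma block_act (a : bool) m x : act_word (if a then [:: m.+1; m] else [:: m; m.+1]) x =
  if a then (if x == m then m.+1 else if x == m.+1 then m.+2 else if x == m.+2 then m else x)
  else (if x == m then m.+2 else if x == m.+1 then m else if x == m.+2 then m.+1 else x).
Proof. by case: a; rewrite /act_word /= /adj_swap; do !case: eqP => //=; lia. Qed.

Definition blockE := (block_act, fun m => block_act true m, fun m => block_act false m).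

Lemma obstruction_step m p : J m.+1 -> ~~ st m.+1 ->
  let b := act_word (if o m then [:: m.+1; m] else [:: m; m.+1]) in
  ob m.+2 p = if (if st m then o m.-1 else o m) then b (ob m.+1 p) else ob m.+1 (b p).
Proof.
move=> Jm nst; rewrite obstructionS Jm (negbTE nst) /=.
by case: ifP => _; rewrite act_word_cat.
Qed.

Lemma nonstart m : ~~ st m.+1 -> J m /\ (~~ st m -> o m.-1 = o m).
Proof.
rewrite chain_startS negb_or negbK => /andP[-> h]; split=> // sm.
by move: h; rewrite sm /= negbK => /eqP.
Qed.

(** This keeps the chains from lying below the obstruction. The induction follows the recursion of
    [obstruction]: the new block moves only [m], [m.+1] and [m.+2], so the essential case is a chain
    ending at the last letter [m.+1]. *)
Lemma obstruction_avoids l s e : complete o l s e -> (forall x, s <= x < e -> o x) ->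
  forall p, p <= s -> ob l p <= e.
Proof.
elim: l s e => [|l IH] s e [[se sts sJ sn] el fin] hasc p ps; first lia.
have old : e < l -> ob l p <= e.
  move=> el'; apply: (IH s) => //; split=> //.
  by case: fin => [/eqP|fin]; [rewrite eqSS => /eqP|right]; lia.
case: (boolP (~~ J l || st l)) => [h|].
  rewrite obstruction_step_id //; case: (ltngtP e l) => [/old //|le|ee]; first lia.
  case: (ltngtP s l) => [sl|ls|e1]; try lia; last by rewrite obstruction_le //; lia.
  have := sn l; have := sJ l; move: h; case: (J l); case: (st l) => //=; lia.
rewrite negb_or negbK => /andP[Jl nl].
case: l IH el fin old Jl nl => [//|m] IH el fin old Jl nl.
have [Jm om] := nonstart nl.
rewrite obstruction_step //= !block_act.
case: (ltngtP e m.+1) => [em|me|ee]; [|lia|].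
  case: (e =P m) fin => [->|em' _]; first by rewrite Jl (negbTE nl) /=; case=> [|[]]; lia.
  have := old em; clear IH old om hasc nl Jl Jm.
  case: (if st m then _ else _); case: (o m); do !case: eqP => //; lia.
clear old fin om.
(* Either the chain is just [m, m.+1], or induction applies to the chain without its last letter. *)
case: (boolP (st m)) => [sm|nsm].
  have em : s = m.
    case: (ltngtP s m) => // h; first by have := sn m; rewrite sm ee; lia.
    have es : s = m.+1 by lia.
    by move: sts; rewrite es (negbTE nl).
  have -> : o m by apply: hasc; lia.
  clear IH hasc nl Jl Jm.
  case: (o m.-1); last by rewrite obstruction_le ?ee //; do ?case: eqP; lia.
  have := @obstruction_le m m p (leqnn m); rewrite -obstruction_step_id ?sm ?orbT //.
  by do !case: eqP; lia.
have es : s <= m.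
  rewrite leqNgt; apply/negP => h; have es : s = m.+1 by lia.
  by move: sts; rewrite es (negbTE nl).
have sm : s < m by rewrite ltn_neqAle es andbT; apply/eqP => e1; rewrite -e1 sts in nsm.
have omT : o m by apply: hasc; lia.
rewrite omT; have : ob m.+1 p <= m.
  apply: (IH s) => //; last by move=> x xm; apply: hasc; lia.
  split; rewrite ?Jl; [split => // [x xm|x xm]; [apply: sJ|apply: sn]; lia|lia|by left].
clear IH hasc nl nsm Jl Jm omT.
by do !case: eqP; lia.
Qed.

(** The counterpart of [obstruction_avoids]: it places the obstruction above every subword that
    misses a letter of each chain. The induction again adds one block at a time. *)
Lemma crossing_obstruction l i j : i < j -> j <= l -> monotone o i j ->
  (forall s e, i <= s -> e < j -> ~ complete o l s e) ->
  exists2 p, p <= i & j <= ob l p.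
Proof.
elim: l i j => [|l IH] i j ij jl [inJ inA] nc; first lia.
case: (boolP (~~ J l || st l)) => [h|].
  rewrite obstruction_step_id //; apply: IH => //.
    rewrite leqNgt; apply/negP => lj; have ej : j = l.+1 by lia.
    case/orP: h => [|sl]; first by rewrite inJ //; lia.
    apply: (nc l l); try lia; split=> //; last by left.
    by split=> // x; [move=> xl; apply: inJ; lia|lia].
  move=> s e si ej [ch el fin]; apply: (nc s e si ej); split; [done|lia|right].
  by case: fin => [->|//]; apply/orP.
rewrite negb_or negbK => /andP[Jl nl].
case: l IH jl nc Jl nl => [//|m] IH jl nc Jl nl.
have [Jm om] := nonstart nl.
have IH' k : i < k -> k <= j -> k <= m -> exists2 p, p <= i & k <= ob m.+1 p.
  move=> ik kj km; apply: IH => //; first lia.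
    by split=> x; [move=> xk; apply: inJ; lia|move=> ix xk; apply: inA; lia].
  move=> s e si ek [ch el fin]; apply: (nc s e si); first lia.
  by split=> //; [lia|right; case: fin => // [[]]; lia].
(* The word permutes the points up to [n], so the point that ends at [k] starts at [n] or lower. *)
have pre k n : k <= n -> m.+1 <= n -> exists2 p, p <= n & ob m.+1 p = k.
  move=> kn mn; exists (act_word (rev (obstruction o m.+1)) k); last exact: act_wordVK.
  by rewrite -(obstruction_le _ mn) act_wordVK.
suff : exists2 p, p <= i & j <= if (if st m then o m.-1 else o m)
    then act_word (if o m then [:: m.+1; m] else [:: m; m.+1]) (ob m.+1 p)
    else ob m.+1 (act_word (if o m then [:: m.+1; m] else [:: m; m.+1]) p).
  by case=> p pi jp; exists p; rewrite ?obstruction_step.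
have small : j <= m -> exists2 p, p <= i & j <= if (if st m then o m.-1 else o m)
    then act_word (if o m then [:: m.+1; m] else [:: m; m.+1]) (ob m.+1 p)
    else ob m.+1 (act_word (if o m then [:: m.+1; m] else [:: m; m.+1]) p).
  move=> jm; have [p pi jp] := IH' j ij (leqnn _) jm; exists p => //.
  by rewrite !blockE; case: ifP => _; case: (o m); move: jp; do !case: eqP => //; lia.
have [/small //|mj] := leqP j m.
(* The new block matters only if the interval ends with the letter [m] or with the letter [m.+1]. *)
have [ej|ej] : j = m.+1 \/ j = m.+2 by lia.
  case: (boolP (st m)) => [sm|nsm].
    have fixm p : m < p -> ob m.+1 p = p by rewrite obstruction_step_id ?sm ?orbT //; apply: obstruction_fix.
    have [im|im] := ltnP i m.
      have -> : o m.-1 by apply: inA; lia.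
      have [p pi mp] := IH' m im (ltnW mj) (leqnn _); exists p => //.
      have : ob m.+1 p <= m by rewrite obstruction_step_id ?sm ?orbT // obstruction_le //; lia.
      by rewrite blockE; case: (o m); do !case: eqP; lia.
    have ei : i = m by lia.
    case: (o m.-1).
      exists (act_word (rev (obstruction o m.+1)) m); last by rewrite act_wordVK blockE eqxx; case: (o m); lia.
      rewrite ei -(@obstruction_le m m) // -obstruction_step_id ?sm ?orbT // act_wordVK; exact: leqnn.
    by exists m; rewrite ?ei // blockE eqxx; case: (o m); rewrite fixm; lia.
  have [im|im] := ltnP i m.
    have -> : o m by rewrite -om //; apply: inA; lia.
    have [p pi mp] := IH' m im (ltnW mj) (leqnn _); exists p => //.
    have : ob m.+1 p <= m.+1 by rewrite obstruction_le //; lia.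
    by rewrite blockE; do !case: eqP; lia.
  have ei : i = m by lia.
  case: (o m); last by exists m; rewrite ?ei // blockE eqxx obstruction_fix; lia.
  have [p1 h1 e1] := pre m m.+1 (leqnSn _) (leqnn _).
  have [p2 h2 e2] := pre m.+1 m.+1 (leqnn _) (leqnn _).
  have [p1m|p1m] := leqP p1 m; first by exists p1; rewrite ?ei // blockE e1 eqxx ej.
  exists p2; last by rewrite blockE e2; do !case: eqP; lia.
  rewrite ei; have : p1 <> p2 by move=> e; rewrite e e2 in e1; lia.
  lia.
clear small IH' mj.
case: (boolP (st m)) => [sm|nsm].
  have fixm p : m < p -> ob m.+1 p = p by rewrite obstruction_step_id ?sm ?orbT //; apply: obstruction_fix.
  (* The letters [m, m.+1] form a complete chain, which the interval cannot contain; so the interval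
     is [m.+1] alone. *)
  have ei : i = m.+1.
    have [im|im] := leqP i m; last by lia.
    case: (nc m m.+1 im); first lia; split=> //; last by left.
    split=> // x xm; [apply: inJ; lia|by rewrite (_ : x = m.+1) //; lia].
  have [p1 h1 e1] := pre m m.+1 (leqnSn _) (leqnn _).
  clear om IH.
  case: (o m.-1); case: (boolP (o m)) => omE.
  - by exists m.+1; rewrite ?ei // fixm // blockE; do !case: eqP; lia.
  - by exists p1; rewrite ?ei // e1 blockE; do !case: eqP; lia.
  - by exists m.+1; rewrite ?ei // blockE fixm; do !case: eqP; lia.
  - by exists m; rewrite ?ei // blockE fixm; do !case: eqP; lia.
case: (boolP (o m)) => omE.
  suff [p pi hp] : exists2 p, p <= i & m.+1 <= ob m.+1 p.
    exists p => //; have : ob m.+1 p <= m.+1 by rewrite obstruction_le //; lia.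
    by rewrite blockE; do !case: eqP; lia.
  have [im|im] := leqP i m; last first.
    by have [p h e] := pre m.+1 m.+1 (leqnn _) (leqnn _); exists p; rewrite ?e //; lia.
  apply: IH => //.
    by split=> x; [move=> xk; apply: inJ; lia|move=> ix xk; apply: inA; lia].
  move=> s e si ek [ch el fin].
  have [em|em] := ltnP e m.
    apply: (nc s e si); first lia.
    by split=> //; [lia|right; case: fin => // [[]]; lia].
  (* A complete chain ending at [m] is prolonged by [m.+1] to a complete chain that still lies in
     the interval. *)
  have ee : e = m by lia.
  case: (nc s m.+1 si); first lia; split=> //; last by left.
  case: ch => se sts sJ sn; split=> // [|x xm|x xm]; first lia.
    by apply: inJ; lia.
  have [xe|xe] : x <= e \/ x = m.+1 by lia.
    by apply: sn; lia.
  by rewrite xe.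
have ei : i = m.+1.
  have [im|im] := leqP i m; last by lia.
  by case/negP: omE; apply: inA; lia.
by exists m; rewrite ?ei // blockE eqxx obstruction_fix; lia.
Qed.
End Chains.

Definition chainb (J o : pred nat) s e : bool :=
  [&& s <= e, chain_start J o s, all J (index_iota s e.+1)
    & all (fun x => ~~ chain_start J o x) (index_iota s.+1 e.+1)].

Lemma chainP J o s e : reflect (chain J o s e) (chainb J o s e).
Proof.
apply: (iffP and4P) => [[h1 h2 /allP h3 /allP h4]|[h1 h2 h3 h4]]; split=> //.
- by move=> x xe; apply: h3; rewrite mem_index_iota.
- by move=> x xe; apply: h4; rewrite mem_index_iota.
- by apply/allP => x; rewrite mem_index_iota => xe; apply: h3.
- by apply/allP => x; rewrite mem_index_iota => xe; apply: h4.
Qed.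

Lemma chain_unique J o s s' e : chain J o s e -> chain J o s' e -> s = s'.
Proof.
move=> [se st _ sn] [se' st' _ sn']; case: (ltngtP s s') => // h.
  by have := sn s'; rewrite st'; lia.
by have := sn' s; rewrite st; lia.
Qed.

(** A start preceded by a letter comes after a non-start and a change of direction, which a monotone
    interval does not have. This makes the starts an antichain of the heap. *)
Lemma monotone_chain_start J o i j k k' : monotone J o i j -> i <= k -> k < k' -> k' < j ->
  chain_start J o k -> ~~ chain_start J o k'.
Proof.
case: k' => // x [inJ inA] ik kx xj sk; apply/negP; rewrite chain_startS inJ /=; last lia.
move=> /andP[sx]; case: (k =P x) => [e|kx']; first by rewrite -e sk in sx.
by rewrite !inA //; lia.
Qed.

Lemma complete_exists (J o : pred nat) n s : (forall x, J x -> x < n) ->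
  J s -> chain_start J o s -> exists e, complete J o n s e.
Proof.
move=> Jn Js sts; have ex : exists e, chainb J o s e.
  exists s; apply/chainP; split=> // x; last lia.
  by move=> xs; rewrite (_ : x = s) //; lia.
have ub e : chainb J o s e -> e <= n.
  by move=> /chainP[se _ h _]; apply/ltnW/Jn/h; rewrite se leqnn.
case: (ex_maxnP ex ub) => e /chainP ch emax; have [se _ hJ hn] := ch.
exists e; split=> //; first by apply/Jn/hJ; rewrite se leqnn.
right; case: (boolP (J e.+1)) => Je; [right|by left].
apply/negPn/negP => ne; have := emax e.+1; rewrite ltnn => /(_ _)/negP; case=> //.
apply/chainP; split=> // [|x xe|x xe]; first lia.
  by case: (x =P e.+1) => [-> //|xe']; apply: hJ; lia.
by case: (x =P e.+1) => [-> //|xe']; apply: hn; lia.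
Qed.

Lemma complete_max J o n s e l : complete J o n s e -> (forall x, J x -> x < n) ->
  chain J o s l -> l <= e.
Proof.
move=> [[se sts hJ hn] en fin] Jn [sl _ hJ' hn']; rewrite leqNgt; apply/negP => el.
have h : e.+1 <= l by [].
have Je : J e.+1 by apply: hJ'; lia.
case: fin => [E|[/negP//|st']]; first by have := Jn _ Je; lia.
by have := hn' e.+1; rewrite st'; lia.
Qed.

(** * The obstruction permutation and generators of the upper sets *)

Section Obstruction.
Variables (N : nat) (w : seq nat).
Hypotheses (wN : all (fun l => l < N) w) (uw : uniq w).
Notation Sn := {perm 'I_N.+1}.
Implicit Types (a : Sn) (S : pred nat).

Definition letter_order : pred nat := fun l => index l w < index l.+1 w.
Notation J := (fun l => l \in w).
Notation o := letter_order.
Notation sub_perm := (sub_perm N w).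

Lemma ascending_rev i j : ascending (rev w) i j <-> monotone J (fun l => ~~ o l) i j.
Proof.
have key l : l \in w -> l.+1 \in w -> (index l (rev w) < index l.+1 (rev w)) = ~~ o l.
  move=> lw lw1; have := index_subseq2 l l.+1 (etrans (rev_uniq w) uw).
  rewrite index_mem mem_rev lw1 andbT => <-.
  have := index_subseq2 l.+1 l uw; rewrite index_mem lw andbT.
  rewrite -subseq_rev => ->; rewrite /o -leqNgt ltn_neqAle.
  case: eqP => //= e; have := nth_index 0 lw; rewrite -e nth_index //; lia.
split=> -[h1 h2].
  have h3 l : i <= l < j -> l \in w by rewrite -mem_rev; apply: h1.
  by split=> // l il lj; rewrite -key ?h2 ?h3 //; lia.
split=> [l lij|l il lj]; first by rewrite mem_rev h1.
by rewrite key ?h1 ?h2 //; lia.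
Qed.

Lemma letters_bound (l : nat) : l \in w -> l < N. Proof. by move/(allP wN). Qed.

Definition chain_starts : seq nat := [seq l <- w | chain_start J o l].
(** With the end of the interval left as argument, [chainb] becomes the set of all letters of the
    chain that starts at [s]. *)
Definition chain_set s : pred nat := chainb J o s.
Definition obs_perm : Sn := word_perm N (obstruction J o N).

Lemma monotone_start i j : ascending w i j \/ ascending (rev w) i j ->
  count (fun l => i <= l < j) chain_starts <= 1.
Proof.
move=> h; have key k k' : k \in chain_starts -> k' \in chain_starts ->
    i <= k < j -> i <= k' < j -> k < k' -> False.
  rewrite !mem_filter => /andP[sk _] /andP[sk' _] kij kij' kk.
  case: h => [h|/ascending_rev h].
    by have := @monotone_chain_start J o i j k k' h; rewrite sk sk'; lia.
  by have := monotone_chain_start (k := k) (k' := k') h; rewrite !chain_start_flip sk sk'; lia.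
rewrite -size_filter; set f := filter _ _.
case ef : f => [|k [|k' f']] //.
have uf : uniq f by rewrite !filter_uniq.
have kf : k \in f by rewrite ef inE eqxx.
have kf' : k' \in f by rewrite ef !inE eqxx orbT.
rewrite mem_filter in kf; rewrite mem_filter in kf'; case/andP: kf => h1 h2; case/andP: kf' => h3 h4.
case: (ltngtP k k') => e.
- by case: (key k k').
- by case: (key k' k).
- by move: uf; rewrite ef e /= inE eqxx.
Qed.

Lemma all_obs : all (fun l => l < N) (obstruction J o N).
Proof. exact: obstruction_bound. Qed.

Lemma up_obs i j : j <= N -> i < j ->
  up obs_perm i j <-> exists2 p, p <= i & j <= act_word (obstruction J o N) p.
Proof.
move=> jN ij; split.
  by move=> /existsP[p /andP[pi jp]]; exists p; rewrite // -(word_permE _ all_obs).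
move=> [p pi jp]; have pN : p < N.+1 by lia.
by apply/existsP; exists (Ordinal pN); rewrite pi word_permE ?all_obs.
Qed.

Lemma down_obs i j : j <= N -> i < j ->
  down obs_perm i j <->
  exists2 p, p <= i & j <= act_word (obstruction J (fun l => ~~ o l) N) p.
Proof.
move=> jN ij; rewrite obstruction_flip down_inv /obs_perm -word_perm_rev ?all_obs //.
split.
  move=> /existsP[p /andP[pi jp]]; exists p; rewrite // -(@word_permE N) ?all_rev ?all_obs //.
move=> [p pi jp]; have pN : p < N.+1 by lia.
by apply/existsP; exists (Ordinal pN); rewrite pi word_permE ?all_rev ?all_obs.
Qed.

(** The subword of an ascending chain carries a point across all its gaps, which the obstruction
    does not do. Descending chains are treated through the reversed word. *)
Lemma chain_set_obs s : s \in chain_starts -> ~~ bruhat_le (sub_perm (chain_set s)) obs_perm.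
Proof.
rewrite mem_filter => /andP[sts sw]; apply/negP => le.
have [e ce] := complete_exists letters_bound sw sts.
have [ch eN fin] := ce; have [se _ hJ hn] := ch.
have inC l : s <= l < e.+1 -> chain_set s l.
  move=> sl; apply/chainP; split=> // [|x xl|x xl]; first lia.
    by apply: hJ; lia.
  by apply: hn; lia.
case: (boolP (o s)) => os.
  have hasc x : s <= x < e -> o x by move=> /(chain_direction ch)->.
  have : up (sub_perm (chain_set s)) s e.+1.
    apply/up_sub_perm => //; split=> //; split=> [l sl|l sl le']; first by apply: hJ; lia.
    by apply: (hasc l); lia.
  move/(up_bruhat le)/up_obs; case=> // p ps; rewrite ltnNge.
  by rewrite (obstruction_avoids ce hasc ps).
have hasc x : s <= x < e -> ~~ o x by move=> /(chain_direction ch)->.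
have : down (sub_perm (chain_set s)) s e.+1.
  apply/down_sub_perm => //; split=> //; apply/ascending_rev; split=> [l sl|l sl le'].
    by apply: hJ; lia.
  by apply: hasc; lia.
move/(down_bruhat le)/down_obs; case=> // p ps; rewrite ltnNge.
rewrite (obstruction_avoids _ hasc ps) //; split=> //.
  by split=> // [|x]; rewrite chain_start_flip //; apply: hn.
by case: fin => [|[|]]; rewrite ?chain_start_flip; auto.
Qed.

(** If [S] misses a letter of every chain, then a monotone interval inside [S] contains no complete
    chain, and [crossing_obstruction] applies. *)
Lemma not_below_obs S : ~~ bruhat_le (sub_perm S) obs_perm ->
  exists2 s, s \in chain_starts & forall l, l \in w -> chain_set s l -> S l.
Proof.
move=> nle.
case: (boolP (has (fun s => all (fun l => chain_set s l ==> S l) w) chain_starts)).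
  move=> /hasP[s sK /allP h]; exists s => // l lw; exact/implyP/h.
move=> /hasPn no; case/negP: nle.
have noc i j s e : (forall l, i <= l < j -> S l) -> i <= s -> e < j -> ~ complete J o N s e.
  move=> hS si ej ce; have [[se sts hJ hn] eN fin] := ce.
  have sK : s \in chain_starts by rewrite mem_filter sts hJ // leqnn.
  case/negP: (no _ sK); apply/allP => l lw; apply/implyP => /chainP cl.
  have := complete_max ce letters_bound cl; case: cl => sl _ _ _ le.
  by apply: hS; lia.
have jN i j : i < j -> (forall l, i <= l < j -> l \in w) -> j <= N.
  by case: j => // j ij h; apply: letters_bound; apply: h; lia.
apply: sub_perm_bruhat => // i j ij hS h.
  have jn := jN i j ij h.1; apply/up_obs => //; apply: crossing_obstruction => //.
  by move=> s e; apply: noc.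
move/ascending_rev: h => h; have jn := jN i j ij h.1.
apply/down_obs => //; apply: crossing_obstruction => //.
move=> s e si ej [[se sts hJ hn] eN fin]; apply: (noc i j s e) => //; split=> //.
  by split=> // [|x]; rewrite -chain_start_flip //; apply: hn.
by case: fin => [|[|]]; rewrite ?chain_start_flip; auto.
Qed.

Lemma chain_set_cover l : l \in w -> exists2 s, s \in chain_starts & chain_set s l.
Proof.
move=> lw; have [s ch] := @chain_exists J o l lw; exists s; last exact/chainP.
by case: ch => sl sts hJ _; rewrite mem_filter sts hJ // leqnn.
Qed.

Lemma chain_set_start s s' : s \in chain_starts -> s' \in chain_starts ->
  chain_set s s' = (s == s').
Proof.
rewrite !mem_filter => /andP[sts sw] /andP[sts' sw'].
have self k : chain_start J o k -> k \in w -> chain J o k k.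
  by move=> h kw; split=> // x xk; [rewrite (_ : x = k) //|]; lia.
apply/chainP/eqP => [h|<-]; last exact: self.
exact: chain_unique h (self _ sts' sw').
Qed.

Lemma chain_starts_uniq : uniq chain_starts.
Proof. exact: filter_uniq. Qed.

Definition interval_set i j : pred nat := fun l => i <= l < j.

Lemma monotone_generators a : exists G : seq (pred nat),
  (forall S, ~~ bruhat_le (sub_perm S) a = has (fun g => bruhat_le (sub_perm g) (sub_perm S)) G) /\
  all (fun g => count g chain_starts <= 1) G.
Proof.
(* The generators are the monotone intervals not below [a]; [up] or [down] across the whole interval
   is a boolean test of monotonicity. *)
pose cond (p : nat * nat) := [&& p.1 < p.2, ~~ bruhat_le (sub_perm (interval_set p.1 p.2)) a &
  up (sub_perm (interval_set p.1 p.2)) p.1 p.2 || down (sub_perm (interval_set p.1 p.2)) p.1 p.2].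
pose P := [seq (i, j) | i <- iota 0 N.+1, j <- iota 0 N.+1].
exists [seq interval_set p.1 p.2 | p <- P & cond p]; split; last first.
  rewrite all_map; apply/allP => -[i j] /=; rewrite mem_filter => /andP[/and3P[/= ij _ h] _].
  by apply: monotone_start; case/orP: h => [/up_sub_perm|/down_sub_perm] h; [left|right]; apply h.
move=> S; rewrite has_map; apply/idP/hasP => [nle|[p]]; last first.
  rewrite mem_filter => /andP[/and3P[_ nle _] _] /= le.
  by apply: contra nle; apply: connect_trans le.
apply/hasP/negPn/negP => /hasPn no; case/negP: nle.
have key i j : i < j -> (forall l, i <= l < j -> S l) -> (forall l, i <= l < j -> l \in w) ->
    up (sub_perm (interval_set i j)) i j || down (sub_perm (interval_set i j)) i j ->
    bruhat_le (sub_perm (interval_set i j)) a.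
  move=> ij hS hw hud; apply/negPn/negP => nle.
  have jN : j <= N by case: (j) ij hw => // k ik hw; apply: letters_bound; apply: hw; lia.
  have := no (i, j); rewrite mem_filter /cond ij nle hud /= => /(_ _)/negP; case.
    by apply/allpairsP; exists (i, j); rewrite !mem_iota; split=> //=; lia.
  by apply: sub_perm_mono => // l _; apply: hS.
apply: sub_perm_bruhat => // i j ij hS h.
  have u : up (sub_perm (interval_set i j)) i j by apply/up_sub_perm.
  by refine (up_bruhat _ u); apply: key; rewrite ?u //; apply h.
have u : down (sub_perm (interval_set i j)) i j by apply/down_sub_perm.
refine (down_bruhat _ u); apply: key; rewrite ?u ?orbT //.
by move=> l; rewrite -mem_rev; apply h.
Qed.
End Obstruction.

(** * Cohomology of order complexes *)

Section OrderComplex.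
Import GRing.Theory.
Local Open Scope ring_scope.
Variables (F : zmodType) (T : eqType) (lt : rel T).
Hypotheses (lt_trans : transitive lt) (lt_irr : irreflexive lt).
Implicit Types (phi psi : seq T -> F) (U : pred T) (c t : seq T) (j : nat).

(** The simplicial coboundary, an alternating sum over the faces of [c], unrolled from the first
    vertex; [coface_sum] gives the closed form. *)
Fixpoint coface phi c : F :=
  if c is x :: c' then phi c' - coface (fun t => phi (x :: t)) c' else 0.

Lemma eq_coface phi psi c :
  (forall t, subseq t c -> (size t).+1 = size c -> phi t = psi t) -> coface phi c = coface psi c.
Proof.
elim: c phi psi => //= x c IH phi psi h; congr (_ - _).
  by apply: h => //; apply: subseq_cons.
by apply: IH => t tc st; apply: h; rewrite /= ?eqxx // st.
Qed.

Lemma coface0 c : coface (fun=> 0) c = 0.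
Proof. by elim: c => //= x c ->; rewrite subr0. Qed.

Lemma cofaceB phi psi c : coface (fun t => phi t - psi t) c = coface phi c - coface psi c.
Proof.
elim: c phi psi => [|x c IH] phi psi /=; first by rewrite subr0.
by rewrite IH !opprD addrACA.
Qed.

Lemma cofaceD phi psi c : coface (fun t => phi t + psi t) c = coface phi c + coface psi c.
Proof.
elim: c phi psi => [|x c IH] phi psi /=; first by rewrite addr0.
by rewrite IH opprD addrACA.
Qed.

Lemma coface_coface phi c : coface (coface phi) c = 0.
Proof.
elim: c phi => //= x c IH phi.
by rewrite cofaceB IH subr0 subrr.
Qed.

Definition chain_in U c := sorted lt c && all U c.

Lemma chain_in_subseq U t c : subseq t c -> chain_in U c -> chain_in U t.
Proof.
move=> tc /andP[sc /allP Uc]; apply/andP; split.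
  exact: subseq_sorted sc.
by apply/allP => x /(mem_subseq tc)/Uc.
Qed.

Lemma eq_coface_chain U j phi psi c : (forall t, chain_in U t -> size t = j -> phi t = psi t) ->
  chain_in U c -> size c = j.+1 -> coface phi c = coface psi c.
Proof.
move=> h Uc sc; apply: eq_coface => t tc st; apply: h; first exact: chain_in_subseq Uc.
by move: st; rewrite sc => -[].
Qed.

(** Here [j] counts vertices, so it is the degree plus one. The empty chain is included, which makes
    the cohomology reduced. *)
Definition cocycle U j phi := forall c, chain_in U c -> size c = j.+1 -> coface phi c = 0.
Definition coboundary U j phi :=
  exists psi, forall c, chain_in U c -> size c = j -> phi c = coface psi c.
Definition acyclic U j := forall phi, cocycle U j phi -> coboundary U j phi.
Definition cyclic U j := exists2 phi, cocycle U j phi & ~ coboundary U j phi.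

(** The complex is a cone with apex [g]: prepending [g] to the chains that lack it gives a
    contracting homotopy. *)
Lemma acyclic_cone U j g : U g -> (forall x, U x -> x = g \/ lt g x) -> acyclic U j.
Proof.
move=> Ug gmin phi cyc; pose psi c := if g \in c then 0 else phi (g :: c).
exists psi => c Uc sc.
case: (boolP (g \in c)) => gc; last first.
  have chg : chain_in U (g :: c).
    move: gc Uc; rewrite /chain_in; case: c {sc} => [|x c] /=; first by rewrite Ug.
    rewrite inE negb_or => /andP[gx _] /andP[-> /andP[Ux ->]].
    by case: (gmin x Ux) => [e|->]; [rewrite e eqxx in gx|rewrite Ug Ux].
  have /eqP := cyc _ chg (congr1 S sc); rewrite /= subr_eq0 => /eqP->.
  apply: eq_coface => t tc _; rewrite /psi ifN //.
  by apply: contra gc => /(mem_subseq tc).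
case: c gc Uc sc => // x c gc /andP[/= xc /andP[Ux Uc]] _.
have nxc y : y \in c -> lt x y.
  by move=> yc; have := order_path_min lt_trans xc => /allP/(_ y yc).
have gx : g = x.
  move: gc; rewrite inE => /orP[/eqP //|/nxc xg].
  case: (gmin x Ux) => [-> //|gx].
  by have := lt_trans gx xg; rewrite lt_irr.
subst x; rewrite /=.
have -> : psi c = phi (g :: c).
  by rewrite /psi ifN //; apply/negP => /nxc; rewrite lt_irr.
rewrite (@eq_coface _ (fun=> 0)) ?coface0 ?subr0 // => t _ _.
by rewrite /psi inE eqxx.
Qed.

Section MayerVietoris.
Variables U1 U2 U : pred T.
Hypothesis U12 : forall x, U x = U1 x || U2 x.
Hypothesis up1 : forall x y, U1 x -> lt x y -> U y -> U1 y.
Hypothesis up2 : forall x y, U2 x -> lt x y -> U y -> U2 y.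
Let I := [pred x | U1 x && U2 x].

(** The least element of a chain lies in [U1] or in [U2], and the rest follows since both are upper
    sets in [U]. *)
Lemma ch_union c : chain_in U c -> chain_in U1 c \/ chain_in U2 c.
Proof.
rewrite /chain_in; case: c => [|x c] /=; first by left.
move=> /andP[xc]; rewrite xc /= U12 => /andP[Ux /allP Uc].
have nxc y : y \in c -> lt x y.
  by move=> yc; have := order_path_min lt_trans xc => /allP/(_ y yc).
by case/orP: Ux => Ux; [left|right]; rewrite Ux /=; apply/allP => y yc;
  [apply: up1 Ux (nxc y yc) (Uc y yc)|apply: up2 Ux (nxc y yc) (Uc y yc)].
Qed.

Lemma ch_inter c : chain_in U1 c -> all U2 c -> chain_in I c.
Proof.
move=> /andP[sc h1] h2; rewrite /chain_in sc /=.
by rewrite /I (eq_all (a2 := predI U1 U2)) // all_predI h1.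
Qed.

Lemma chI1 c : chain_in I c -> chain_in U1 c.
Proof. by move=> /andP[sc /allP h]; rewrite /chain_in sc; apply/allP => x /h /andP[]. Qed.

Lemma chI2 c : chain_in I c -> chain_in U2 c.
Proof. by move=> /andP[sc /allP h]; rewrite /chain_in sc; apply/allP => x /h /andP[]. Qed.

Lemma ch1 c : chain_in U1 c -> chain_in U c.
Proof. by move=> /andP[sc /allP h]; rewrite /chain_in sc; apply/allP => x /h; rewrite U12 => ->. Qed.

Lemma ch2 c : chain_in U2 c -> chain_in U c.
Proof.
by move=> /andP[sc /allP h]; rewrite /chain_in sc; apply/allP => x /h; rewrite U12 orbC => ->.
Qed.

Let ext (U' : pred T) phi t := if all U' t then phi t else 0.

Lemma extE (U' : pred T) phi t : chain_in U' t -> ext U' phi t = phi t.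
Proof. by rewrite /ext => /andP[_ ->]. Qed.

(** Exactness of the Mayer-Vietoris sequence at the union. For [j = 0] the intersection would
    contribute chains of negative size, hence the condition [True]. *)
Lemma acyclic_union j : acyclic U1 j -> acyclic U2 j ->
  (if j is j'.+1 then acyclic I j' else True) -> acyclic U j.
Proof.
move=> a1 a2; case: j a1 a2 => [|j] a1 a2 a12 phi cyc.
  have [psi h] := a1 phi (fun c Uc => cyc c (ch1 Uc)).
  by exists psi => -[|//] _ _; apply: h.
have [psi1 h1] := a1 phi (fun c Uc => cyc c (ch1 Uc)).
have [psi2 h2] := a2 phi (fun c Uc => cyc c (ch2 Uc)).
have [|chi hchi] := a12 (fun t => psi1 t - psi2 t).
  by move=> c Ic sc; rewrite cofaceB -h1 ?(chI1 Ic) // -h2 ?(chI2 Ic) // subrr.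
(* The two primitives differ on the intersection by a coboundary; subtracting it from the first,
   after extension by zero, makes them agree there. *)
pose psi t := if all U1 t then psi1 t - coface (ext I chi) t else psi2 t.
exists psi => c Uc sc; case: (boolP (all U1 c)) => c1.
  have Uc1 : chain_in U1 c by case/andP: Uc => cc _; rewrite /chain_in cc.
  rewrite (@eq_coface_chain U1 j _ (fun t => psi1 t - coface (ext I chi) t)) //.
    by rewrite cofaceB coface_coface subr0; apply: h1.
  by move=> t /andP[_ t1] _; rewrite /psi t1.
have Uc2 : chain_in U2 c by case: (ch_union Uc) => // /andP[_ h]; rewrite h in c1.
rewrite (@eq_coface_chain U2 j _ psi2) //; first exact: h2.
move=> t /andP[ct t2] st; rewrite /psi; case: ifP => // t1.
have It : chain_in I t by apply: ch_inter; rewrite // /chain_in ct.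
rewrite (_ : coface _ t = coface chi t); last first.
  case: j {psi1 psi2 h1 h2 a1 a2 cyc a12 sc hchi psi} st => [|j] st.
    by case: t st {ct t2 t1 It}.
  by apply: (@eq_coface_chain I j) => // s Is _; apply: extE.
by rewrite -hchi // subKr.
Qed.

(** The connecting map of the Mayer-Vietoris sequence is injective when both parts are acyclic. Its
    image [f] is the coboundary of [phi] extended by zero, kept on [U1] only. *)
Lemma cyclic_union j : acyclic U1 j -> acyclic U2 j -> cyclic I j -> cyclic U j.+1.
Proof.
move=> a1 a2 [phi cyc ncob]; pose ephi := ext I phi.
have dlI c : chain_in I c -> size c = j.+1 -> coface ephi c = 0.
  by move=> Ic sc; rewrite -(cyc c Ic sc); apply: (@eq_coface_chain I j) => // t It _; apply: extE.
pose f t := if all U1 t then coface ephi t else 0.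
have f2 c : chain_in U2 c -> size c = j.+1 -> f c = 0.
  move=> /andP[sc c2] zc; rewrite /f; case: ifP => // c1; apply: dlI => //.
  by apply: ch_inter; rewrite // /chain_in sc.
have f1 c : chain_in U1 c -> f c = coface ephi c by rewrite /f => /andP[_ ->].
exists f.
  move=> c /ch_union[] Uc sc.
    by rewrite (@eq_coface_chain U1 j.+1 _ (coface ephi)) ?coface_coface // => t /f1.
  by rewrite (@eq_coface_chain U2 j.+1 _ (fun=> 0)) ?coface0 // => t /f2 h; apply: h.
move=> [g hg].
have [|p hp] := a2 g; first by move=> c Uc sc; rewrite -hg ?f2 ?ch2.
have [|q hq] := a1 (fun t => ephi t - g t).
  by move=> c Uc sc; rewrite cofaceB -hg ?f1 ?ch1 // subrr.
apply: ncob; exists (fun t => q t + p t) => c Ic sc.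
by rewrite cofaceD -hp ?chI2 // -hq ?chI1 // subrK /ephi extE.
Qed.
End MayerVietoris.

Section Relative.
Variables (V U : pred T).
Hypothesis UV : forall x, U x -> V x.

Lemma chUV c : chain_in U c -> chain_in V c.
Proof. by move=> /andP[sc /allP h]; rewrite /chain_in sc; apply/allP => x /h /UV. Qed.

(** From the long exact sequence of the pair: a primitive on [V] is a cocycle on [U]; subtracting
    from it the coboundary of its own primitive on [U], extended by zero, makes it vanish on [U]. *)
Lemma relative_coboundary j phi : acyclic V j.+1 -> acyclic U j ->
  cocycle V j.+1 phi -> (forall c, chain_in U c -> size c = j.+1 -> phi c = 0) ->
  exists2 psi, (forall c, chain_in V c -> size c = j.+1 -> phi c = coface psi c)
             & (forall c, chain_in U c -> size c = j -> psi c = 0).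
Proof.
move=> aV aU cyc phiU; have [psi hpsi] := aV _ cyc.
have [|chi hchi] := aU psi; first by move=> c Uc sc; rewrite -hpsi ?phiU // chUV.
pose echi t := if all U t then chi t else 0.
exists (fun t => psi t - coface echi t) => c Uc sc.
  by rewrite cofaceB coface_coface subr0; apply: hpsi.
rewrite hchi //; apply/eqP; rewrite subr_eq0; apply/eqP.
apply: eq_coface => t tc _; rewrite /echi ifT //.
by have /andP[] := chain_in_subseq tc Uc.
Qed.

(** The connecting map from the cohomology of [U] to that of the pair, extension by zero followed by
    [coface], is injective since [V] is acyclic. *)
Lemma relative_cyclic j : acyclic V j -> cyclic U j ->
  exists phi, [/\ cocycle V j.+1 phi, (forall c, chain_in U c -> size c = j.+1 -> phi c = 0)
    & ~ exists2 psi, (forall c, chain_in V c -> size c = j.+1 -> phi c = coface psi c)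
             & (forall c, chain_in U c -> size c = j -> psi c = 0)].
Proof.
move=> aV [psi cyc ncob]; pose epsi t := if all U t then psi t else 0.
exists (coface epsi); split.
- by move=> c _ _; rewrite coface_coface.
- move=> c Uc sc; rewrite -(cyc c Uc sc); apply: eq_coface => t tc _; rewrite /epsi ifT //.
  by have /andP[] := chain_in_subseq tc Uc.
move=> [theta h1 h2]; have [|chi hchi] := aV (fun t => epsi t - theta t).
  by move=> c Vc sc; rewrite cofaceB -h1 // subrr.
apply: ncob; exists chi => c Uc sc.
by rewrite -hchi ?chUV // h2 // subr0 /epsi; case/andP: Uc => _ ->.
Qed.
End Relative.
End OrderComplex.

Section CofaceSum.
Import GRing.Theory.
Local Open Scope ring_scope.

Lemma coface_sum (F : pzRingType) (T : eqType) (phi : seq T -> F) t :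
  coface phi t = \sum_(0 <= j < size t) (-1) ^+ j * phi (take j t ++ drop j.+1 t).
Proof.
elim: t phi => [|x t IH] phi /=; first by rewrite big_geq.
rewrite big_nat_recl //= expr0 mul1r drop0; congr (_ + _).
rewrite IH -sumrN; apply: eq_bigr => j _.
by rewrite exprS mulN1r mulNr.
Qed.
End CofaceSum.

(** * Upper sets generated by sets of letters *)

Definition pred_union (g g' : pred nat) : pred nat := fun l => g l || g' l.

Lemma eq_chain_in (T : eqType) (lt : rel T) (U U' : pred T) c :
  U =1 U' -> chain_in lt U c = chain_in lt U' c.
Proof. by move=> e; rewrite /chain_in (eq_all e). Qed.

Lemma acyclic_eq (F : zmodType) (T : eqType) (lt : rel T) (U U' : pred T) j :
  U =1 U' -> acyclic F lt U j -> acyclic F lt U' j.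
Proof.
move=> e a phi cyc; have [|psi h] := a phi.
  by move=> c Uc; apply: cyc; rewrite -(eq_chain_in _ _ e).
by exists psi => c Uc; apply: h; rewrite (eq_chain_in _ _ e).
Qed.

Lemma cyclic_eq (F : zmodType) (T : eqType) (lt : rel T) (U U' : pred T) j :
  U =1 U' -> cyclic F lt U j -> cyclic F lt U' j.
Proof.
move=> e [phi cyc ncob]; exists phi; first by move=> c Uc; apply: cyc; rewrite (eq_chain_in _ _ e).
by move=> [psi h]; apply: ncob; exists psi => c Uc; apply: h; rewrite -(eq_chain_in _ _ e).
Qed.

Section UpperSets.
Variables (F : fieldType) (N : nat) (w : seq nat).
Hypotheses (wN : all (fun l => l < N) w) (uw : uniq w).
Notation Sn := {perm 'I_N.+1}.
Notation lt := (@bruhat_lt N.+1).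
Notation sub_perm := (sub_perm N w).
Notation v := (word_perm N w).
Implicit Types (x : Sn) (G : seq (pred nat)) (g : pred nat) (j : nat).

Lemma sub_perm_top : sub_perm xpredT = v.
Proof. by rewrite /sub_perm filter_predT. Qed.

Lemma below_top x : bruhat_le x v -> exists S, x = sub_perm S.
Proof. by rewrite -sub_perm_top; apply: below_sub_perm. Qed.

Lemma sub_perm_le_top S : bruhat_le (sub_perm S) v.
Proof. by rewrite -sub_perm_top; apply: sub_perm_mono. Qed.

Lemma bruhat_refl (x : Sn) : bruhat_le x x.
Proof. exact: connect0. Qed.

Lemma bruhat_anti (x y : Sn) : bruhat_le x y -> bruhat_le y x -> x = y.
Proof.
move=> /bruhat_le_coxlen[-> //|h1] /bruhat_le_coxlen[-> //|h2].
by have := ltn_trans h1 h2; rewrite ltnn.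
Qed.

Lemma top_le_sub_perm S : bruhat_le v (sub_perm S) <-> forall l, l \in w -> S l.
Proof.
rewrite -sub_perm_top; split=> [h l lw|h]; first by apply: (sub_perm_le wN uw h).
by apply: sub_perm_mono => // l lw _; apply: h.
Qed.

Definition upper_set G : pred Sn :=
  fun x => lt x v && has (fun g => bruhat_le (sub_perm g) x) G.

Lemma upper_set_up G (U : pred Sn) x y : {subset U <= [pred x | lt x v]} ->
  upper_set G x -> lt x y -> U y -> upper_set G y.
Proof.
move=> sub /andP[_ h] /andP[_ xy] /sub Uy; apply/andP; split=> //.
by apply: sub_has h => g gx; apply: connect_trans gx xy.
Qed.

(** As [g] misses the letter [l], its subword is strictly below [v] and is the least element of the
    upper set, which is therefore a cone. *)
Lemma acyclic_upper1 g l j : l \in w -> ~~ g l -> acyclic F lt (upper_set [:: g]) j.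
Proof.
move=> lw gl; apply: (@acyclic_cone _ _ lt (@bruhat_lt_trans N) (@bruhat_lt_irr N) _ j (sub_perm g)).
  rewrite /upper_set /= orbF bruhat_refl andbT /bruhat_lt sub_perm_le_top andbT.
  by apply: contraNneq gl => e; apply: (top_le_sub_perm g).1 => //; rewrite e bruhat_refl.
move=> x; rewrite /upper_set /= orbF => /andP[_ gx].
by case: (sub_perm g =P x) => [->|/eqP ne]; [left|right; rewrite /bruhat_lt ne].
Qed.

(** In the Boolean lattice below [v], joins are unions of sets of letters. *)
Lemma upper_set_inter g G x : upper_set [:: g] x && upper_set G x =
  upper_set [seq pred_union g g' | g' <- G] x.
Proof.
rewrite /upper_set /= orbF; case: (boolP (lt x v)) => //= /andP[_ /below_top[S ->]].
have key g' : bruhat_le (sub_perm g) (sub_perm S) && bruhat_le (sub_perm g') (sub_perm S) = bruhat_le (sub_perm (pred_union g g')) (sub_perm S).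
  apply/andP/idP => [[h1 h2]|h].
    apply: sub_perm_mono => // l lw /orP[gl|gl]; first by apply: (sub_perm_le wN uw h1).
    by apply: (sub_perm_le wN uw h2).
  by split; apply: connect_trans h; apply: sub_perm_mono => // l _; rewrite /pred_union => ->; rewrite ?orbT.
by rewrite has_map /=; elim: G => /= [|g' G <-]; rewrite ?andbF // andb_orr key.
Qed.

Lemma upper_set_cons g G x : upper_set (g :: G) x = upper_set [:: g] x || upper_set G x.
Proof. by rewrite /upper_set /= orbF -andb_orr. Qed.

Lemma upper_set_sub G : {subset upper_set G <= [pred x | lt x v]}.
Proof. by move=> x /andP[]. Qed.

(* K stands for an antichain of letters: as each generator contains at most one
   element of K, fewer than [size K] generators never cover K. *)
Lemma acyclic_upper_set G (K : seq nat) j : {subset K <= w} -> G <> [::] ->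
  all (fun g => count g K <= 1) G -> j.+1 < size K -> acyclic F lt (upper_set G) j.
Proof.
move: {2}(size G) (leqnn (size G)) => m; elim: m G K j => [|m IH] [|g G] K j //= Gm Kw _ /andP[gK GK] jK.
(* There are at least two elements in [K], and [g] contains at most one. *)
have [l lK gl] : exists2 l, l \in K & ~~ g l.
  apply/hasP; rewrite has_predC; apply/negP; rewrite all_count => /eqP e.
  by move: gK; rewrite e; case: (size K) jK => [|[]].
have [->|nG] : G = [::] \/ G <> [::] by case: (G); [left|right].
  exact: (acyclic_upper1 (Kw _ lK) gl).
apply: (@acyclic_union _ _ lt (@bruhat_lt_trans N) (upper_set [:: g]) (upper_set G)).
- exact: upper_set_cons.
- by move=> x y; apply: upper_set_up; apply: upper_set_sub.
- by move=> x y; apply: upper_set_up; apply: upper_set_sub.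
- exact: (acyclic_upper1 (Kw _ lK) gl).
- exact: IH GK jK.
case: j jK => // j jK; apply: (@acyclic_eq _ _ _ (upper_set [seq pred_union g g' | g' <- G])).
  by move=> x; rewrite -upper_set_inter.
(* On the intersection, [K] loses at most the one element lying in [g], while the degree drops by
   one. *)
apply: (IH _ [seq l <- K | ~~ g l]); rewrite ?size_map //.
- by move=> k; rewrite mem_filter => /andP[_ /Kw].
- by case: (G) nG.
- rewrite all_map; apply: sub_all GK => g' /= g'K; apply: leq_trans g'K.
  rewrite count_filter; apply: sub_count => k /= /andP[/orP[->|] //].
- have -> : size [seq l <- K | ~~ g l] = size K - count g K.
    by rewrite size_filter -(count_predC g K) addKn.
  by lia.
Qed.

(** This is the cohomology of the boundary of a simplex with vertices [ks]. In the Mayer-Vietoris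
    induction, the intersection of the part of [C k] with the rest is generated by the unions of
    [C k] with the other sets, a family of the same kind indexed by the remaining [ks]. *)
Lemma cyclic_upper_set (ks : seq nat) (C : nat -> pred nat) : uniq ks -> ks <> [::] ->
  {subset ks <= w} -> {in ks &, forall k k', C k k' = (k == k')} ->
  (forall l, l \in w -> exists2 k, k \in ks & C k l) ->
  cyclic F lt (upper_set [seq C k | k <- ks]) (size ks).-1.
Proof.
elim: ks C => [//|k ks IH] C /= /andP[kks uks] _ ksw Cks cov.
case: (ks =P [::]) => [e|nks].
  (* A single generator contains all letters, so the upper set is empty, and 1 on the empty chain is
     no coboundary. *)
  rewrite e /=; exists (fun=> 1%R).
    move=> [|x [|//]] // /andP[_ /= /andP[]]; rewrite /upper_set /= orbF => /andP[/andP[xv xv'] h].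
    case/eqP: xv; apply: bruhat_anti => //; apply: connect_trans h.
    by apply/top_le_sub_perm => l /cov[k']; rewrite e inE => /eqP->.
  by move=> [psi /(_ [::] isT erefl)] /= /eqP; rewrite GRing.oner_eq0.
have [k' k'ks] : exists k', k' \in ks by case: (ks) nks => // k' s _; exists k'; rewrite inE eqxx.
have nk z : z \in ks -> (z == k) = false by move=> zks; apply: contraNF kks => /eqP<-.
have -> : size ks = (size ks).-1.+1 by case: (ks) nks.
apply: (@cyclic_union _ _ lt (@bruhat_lt_trans N) (upper_set [:: C k]) (upper_set [seq C k | k <- ks])).
- exact: upper_set_cons.
- by move=> x y; apply: upper_set_up; apply: upper_set_sub.
- by move=> x y; apply: upper_set_up; apply: upper_set_sub.
- apply: (@acyclic_upper1 _ k'); first by apply: ksw; rewrite inE k'ks orbT.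
  by rewrite Cks ?inE ?eqxx ?k'ks ?orbT // eq_sym nk.
- apply: (@acyclic_upper_set _ (k :: ks)) => //.
  + by case: (ks) nks.
  + rewrite all_map; apply/allP => z zks; change (count (C z) (k :: ks) <= 1).
    rewrite (eq_in_count (a2 := pred1 z)); last first.
      by move=> y yks /=; rewrite Cks // ?inE ?zks ?orbT // eq_sym.
    by rewrite count_uniq_mem /= ?kks // leq_b1.
  + by case: (ks) nks.
apply: (@cyclic_eq _ _ _ (upper_set [seq pred_union (C k) (C z) | z <- ks])).
  by move=> x; rewrite -[RHS]/(upper_set [:: C k] x && upper_set [seq C k | k <- ks] x)
    upper_set_inter -map_comp.
apply: (IH (fun z => pred_union (C k) (C z))) => //.
- by move=> z zks; apply: ksw; rewrite inE zks orbT.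
- move=> y z yks zks; rewrite /pred_union !Cks ?inE ?eqxx ?yks ?zks ?orbT //.
  by rewrite eq_sym nk.
- move=> l /cov[z]; rewrite inE => /orP[/eqP->|zks] Cl.
    by exists k' => //; rewrite /pred_union Cl.
  by exists z => //; rewrite /pred_union Cl orbT.
Qed.
End UpperSets.

(** * Ext groups from a simple module to the regular module *)

Section Ext.
Import GRing.Theory.
Local Open Scope ring_scope.
Variables (F : fieldType) (N : nat) (v : {perm 'I_N.+1}).
Notation Sn := {perm 'I_N.+1}.
Notation lt := (@bruhat_lt N.+1).
Notation actM := (simple_act F v).
Notation actN := (@reg_act N.+1 F).
Notation dim := (reg_dim N.+1).
Implicit Types (f g h : seq Sn -> 'M[F]_(dim, 1)) (c t : seq Sn) (a : Sn) (r : 'I_dim).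

Let basis_elt r : Sn * Sn := enum_val r.
Let V : pred Sn := [pred x | lt x v].

(** The coordinate of a cochain in [A e_a], on the chain [t] completed by [v]. At most one index is
    summed, and none unless [head v t] is below [a]. *)
Definition component a h t : F := \sum_(r | basis_elt r == (a, head v t)) h (rcons t v) r 0.

Lemma component0 a h t : ~~ bruhat_le (head v t) a -> component a h t = 0.
Proof.
move=> nle; rewrite /component big1 // => r /eqP e.
by have := enum_valP r; rewrite -/(basis_elt r) e inE /= (negbTE nle).
Qed.

Lemma componentE h t r : (basis_elt r).2 = head v t -> component (basis_elt r).1 h t = h (rcons t v) r 0.
Proof.
move=> e; rewrite /component (big_pred1 r) // => s /=.
by rewrite -e -surjective_pairing; apply: (inj_eq enum_val_inj).
Qed.

Lemma is_chain_rcons t : is_chain (rcons t v) = chain_in lt V t.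
Proof.
rewrite /is_chain /chain_in !(sorted_pairwise (@bruhat_lt_trans N)) pairwise_rcons.
by rewrite andbC.
Qed.

Lemma mul_actN p q (M : 'M[F]_(dim, 1)) r : bruhat_le q p ->
  (actN p q *m M) r 0 = if (basis_elt r).2 == q then \sum_(s | basis_elt s == ((basis_elt r).1, p)) M s 0 else 0.
Proof.
move=> qp; rewrite mxE; case: eqP => e.
  rewrite [RHS]big_mkcond; apply: eq_bigr => s _; rewrite mxE qp /= -!/(basis_elt _).
  case: (basis_elt r) e => a b /= ->; case: (basis_elt s) => c d /=.
  rewrite !xpair_eqE eqxx andbT [a == c]eq_sym andbC.
  by case: ifP; rewrite ?mul1r ?mul0r.
apply: big1 => s _; rewrite mxE -!/(basis_elt _).
case: (basis_elt r) e => b d /= /eqP/negbTE e.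
by rewrite xpair_eqE e !andbF mul0r.
Qed.

Lemma simple_act_neq p q : p != q -> actM p q = 0.
Proof.
move=> pq; rewrite /simple_act (_ : _ && _ = false) ?scalemx0 //.
  by apply/matrixP => i j; rewrite !mxE mul0rn.
by apply/negP => /andP[/eqP e /eqP e']; rewrite e e' eqxx in pq.
Qed.

(** The condition of [cochain], entry by entry: values are supported on paths ending at the first
    vertex of the chain, and vanish unless the chain ends at [v]. *)
Definition homogeneous f c : Prop :=
  forall r, ~~ ((last 1%g c == v) && ((basis_elt r).2 == head 1%g c)) -> f c r 0 = 0.

Lemma homogeneousP f c : homogeneous f c <->
  f c = actN (head 1%g c) (head 1%g c) *m f c *m actM (last 1%g c) (last 1%g c).
Proof.
have E r : (actN (head 1%g c) (head 1%g c) *m f c *m actM (last 1%g c) (last 1%g c)) r 0 =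
    if (last 1%g c == v) && ((basis_elt r).2 == head 1%g c) then f c r 0 else 0.
  rewrite mxE big_ord1 mul_actN ?bruhat_refl // !mxE andbb.
  case: (last _ _ == v) => /=; last by rewrite mul0rn mulr0.
  rewrite mulr1n mulr1; case: eqP => // <-.
  rewrite -surjective_pairing (big_pred1 r) // => s.
  exact: (inj_eq enum_val_inj).
split=> [hf|e r /negbTE nr]; last by rewrite e E nr.
apply/matrixP => r k; rewrite (ord1 k) E; case: ifP => // /negbT; exact: hf.
Qed.

Lemma homogeneous_eq f g c : is_chain c -> (0 < size c)%N -> homogeneous f c -> homogeneous g c ->
  (forall t a, c = rcons t v -> component a f t = component a g t) -> f c = g c.
Proof.
move=> cc; case/lastP: c cc => // t x cc _ hf hg e; apply/matrixP => r k; rewrite (ord1 k).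
case: (boolP ((last 1%g (rcons t x) == v) && ((basis_elt r).2 == head 1%g (rcons t x)))) => h; last first.
  by rewrite hf ?hg.
move: h; rewrite last_rcons => /andP[/eqP xv /eqP hr]; subst x.
have hr' : (basis_elt r).2 = head v t by rewrite hr; case: (t).
by rewrite -!componentE // e.
Qed.

Lemma is_chain_subseq c c' : subseq c' c -> is_chain c -> is_chain c'.
Proof. exact/subseq_sorted/bruhat_lt_trans. Qed.

Lemma drop_nth_subseq (T : eqType) j (c : seq T) : subseq (take j c ++ drop j.+1 c) c.
Proof.
rewrite -{3}(cat_take_drop j c); apply: cat_subseq => //.
by rewrite -add1n -drop_drop drop_subseq.
Qed.

Lemma last_delete (T : Type) (x : T) j (c : seq T) : (j.+1 < size c)%N ->
  last x (take j c ++ drop j.+1 c) = last x c.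
Proof.
move=> jc; rewrite -{3}(cat_take_drop j.+1 c) !last_cat.
by case e : (drop j.+1 c) => //; move: jc; rewrite -subn_gt0 -size_drop e.
Qed.

(** Arrows act by zero on the simple module, which removes the last term of the bar differential. *)
Lemma cobound_simple i g c : is_chain c -> size c = i.+2 -> cobound actM actN i.+1 g c =
  actN (nth 1%g c 1) (nth 1%g c 0) *m g (behead c)
  + \sum_(1 <= j < i.+1) (-1) ^+ j *: g (take j c ++ drop j.+1 c).
Proof.
move=> /(sortedP 1%g) cc sc; rewrite /cobound simple_act_neq ?mulmx0 ?scaler0 ?addr0 //.
by have := cc i; rewrite sc ltnSn /= => /(_ isT)/andP[ne _]; rewrite eq_sym.
Qed.

Lemma homogeneous_cobound i g c : is_chain c -> size c = i.+2 ->
  (forall c', is_chain c' -> size c' = i.+1 -> homogeneous g c') ->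
  homogeneous (cobound actM actN i.+1 g) c.
Proof.
move=> cc sc hg r nr; rewrite cobound_simple // mxE summxE.
have size_del j : (j < i.+2)%N -> size (take j c ++ drop j.+1 c) = i.+1.
  by move=> ji; rewrite size_cat size_take size_drop sc ji subSS subnKC.
have chain_del j : is_chain (take j c ++ drop j.+1 c).
  exact: is_chain_subseq (drop_nth_subseq _ _) cc.
have lexy : bruhat_le (nth 1%g c 0) (nth 1%g c 1).
  by move/(sortedP 1%g): (cc) => /(_ 0); rewrite sc => /(_ isT)/andP[].
rewrite mul_actN // [X in _ + X]big1_seq ?addr0; last first.
  move=> j /andP[_]; rewrite mem_index_iota => /andP[j1 ji]; rewrite mxE.
  rewrite (hg _ (chain_del j)) ?mulr0 ?size_del ?(leq_trans ji) //.
  rewrite last_delete ?sc //; case: j j1 {ji} => // j _.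
  by move: nr; case: (c).
case: ifP => // hr; apply: big1 => s _; apply: hg.
- by apply: is_chain_subseq cc; rewrite -drop1 drop_subseq.
- by rewrite size_behead sc.
move: nr sc hr; case: (c) => [|x [|y c']] //= nr _ hr.
by rewrite hr andbT in nr; rewrite negb_and nr.
Qed.

(** This turns the bar complex with values in [A e_a] into simplicial cochains on the chains below
    [v]: the module action gives the face without [x], and the inner terms give the other faces. *)
Lemma component_cobound a g x t : chain_in lt V (x :: t) ->
  component a (cobound actM actN (size (x :: t)) g) (x :: t) = coface (component a g) (x :: t).
Proof.
move=> Vt; have cc : is_chain (rcons (x :: t) v) by rewrite is_chain_rcons.
have lexy : bruhat_le x (head v t).
  by move: cc; rewrite /is_chain /=; case: (t) => [|y t'] /= /andP[/andP[]].
rewrite coface_sum big_ltn // expr0 mul1r take0 drop1 /=.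
rewrite {1}/component.
have sz : size (rcons (x :: t) v) = (size t).+2 by rewrite size_rcons.
rewrite (cobound_simple g cc sz).
set A := _ *m _; pose B j := (-1) ^+ j *: g (take j (rcons (x :: t) v) ++ drop j.+1 (rcons (x :: t) v)).
have E r : (A + \sum_(1 <= j < (size t).+1) B j) r 0 = A r 0 + \sum_(1 <= j < (size t).+1) B j r 0.
  by rewrite mxE summxE.
rewrite (eq_bigr _ (fun r _ => E r)) /A /B => {E A B}.
rewrite big_split /= exchange_big /=; congr (_ + _).
  (* The path from [head v t] to [x] sends the basis element [(a, head v t)] to [(a, x)]; if
     [head v t] is not below [a], both sides are zero. *)
  case: (boolP (bruhat_le (head v t) a)) => ha; last first.
    rewrite component0 // big1 // => r /eqP e.
    have nth1 : nth 1%g (rcons t v) 0 = head v t by case: (t).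
    rewrite nth1 mul_actN // e /= eqxx big1 // => s /eqP es.
    by have := enum_valP s; rewrite -/(basis_elt s) es inE /= (negbTE ha).
  have xa : (a, x) \in reg_basis N.+1 by rewrite inE; apply: connect_trans lexy ha.
  rewrite (big_pred1 (enum_rank_in xa (a, x))); last first.
    move=> r; rewrite -{1}(enum_rankK_in xa xa); exact: (inj_eq enum_val_inj).
  have nth1 : nth 1%g (rcons t v) 0 = head v t by case: (t).
  by rewrite nth1 mul_actN // /basis_elt enum_rankK_in //= eqxx.
rewrite big_seq [RHS]big_seq; apply: eq_bigr => j; rewrite mem_index_iota => /andP[j1 jt].
case: j j1 jt => // j _ jt; rewrite /component mulr_sumr /=.
apply: eq_bigr => r _; rewrite mxE; congr (_ * g _ _ _).
rewrite /= rcons_cat /= -cats1; congr (_ :: _).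
rewrite -cats1 take_cat drop_cat; move: jt; rewrite ltnS => jt; rewrite jt.
case: (ltngtP j.+1 (size t)) => h; first by rewrite cats1.
  by rewrite ltnNge jt in h.
by rewrite h subnn drop0 drop_size.
Qed.
(** Cochains on the elements below [v] relative to those not below [a]: a chain lies among the
    latter as soon as its first vertex does. On the empty chain the test is on [v] itself. *)
Definition rel_cocycle a i (phi : seq Sn -> F) : Prop :=
  (forall t, chain_in lt V t -> size t = i.+1 -> coface phi t = 0) /\
  (forall t, chain_in lt V t -> size t = i -> ~~ bruhat_le (head v t) a -> phi t = 0).

Definition rel_coboundary a i (phi : seq Sn -> F) : Prop :=
  exists psi : seq Sn -> F, (forall t, chain_in lt V t -> size t = i -> phi t = coface psi t) /\
  (forall t, chain_in lt V t -> (size t).+1 = i -> ~~ bruhat_le (head v t) a -> psi t = 0).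

Definition assemble (Psi : Sn -> seq Sn -> F) c : 'M[F]_(dim, 1) :=
  \col_r (if (last 1%g c == v) && ((basis_elt r).2 == head 1%g c)
          then Psi (basis_elt r).1 (take (size c).-1 c) else 0).

Lemma homogeneous_assemble Psi c : homogeneous (assemble Psi) c.
Proof. by move=> r /negbTE nr; rewrite mxE nr. Qed.

Lemma component_assemble Psi a t :
  component a (assemble Psi) t = if bruhat_le (head v t) a then Psi a t else 0.
Proof.
case: ifP => h; last by rewrite component0 ?h.
have xa : (a, head v t) \in reg_basis N.+1 by rewrite inE.
have e : basis_elt (enum_rank_in xa (a, head v t)) = (a, head v t) by rewrite /basis_elt enum_rankK_in.
have := @componentE (assemble Psi) t (enum_rank_in xa (a, head v t)); rewrite e => ->//.
rewrite mxE e last_rcons eqxx size_rcons /= -cats1 take_size_cat //.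
by rewrite (_ : head 1%g (t ++ [:: v]) = head v t) ?eqxx //; case: (t).
Qed.

Lemma cochainP i f : cochain actM actN i f <->
  forall c, is_chain c -> size c = i.+1 -> homogeneous f c.
Proof. by split=> h c cc sc; apply/homogeneousP; apply: h. Qed.

Lemma rel_cocycle_component a i f : cochain actM actN i f ->
  (forall c, is_chain c -> size c = i.+2 -> cobound actM actN i.+1 f c = 0) ->
  rel_cocycle a i (component a f).
Proof.
move=> _ cyc; split=> [[|x t] // Vt [st]|t Vt _]; last exact: component0.
rewrite -component_cobound // /component big1 // => r _.
rewrite /= st cyc ?mxE //; first by rewrite -rcons_cons is_chain_rcons.
by rewrite /= size_rcons st.
Qed.

Lemma Ext_zero i : (forall a phi, rel_cocycle a i phi -> rel_coboundary a i phi) ->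
  ~ Ext_nonzero actM actN i.
Proof.
move=> H [f [fc cyc ncob]]; have fh := (cochainP i f).1 fc.
(* Since [A] is the sum of the [A e_a], primitives are chosen for all [a] at once and then glued by
   [assemble]. *)
have /fin_all_exists[Psi hPsi] a := H a _ (rel_cocycle_component a fc cyc).
have comp t a : chain_in lt V t -> size t = i -> component a f t = coface (Psi a) t.
  by have [h _] := hPsi a; apply: h.
case: i H fc cyc ncob fh hPsi comp => [|i] H fc cyc ncob fh hPsi comp; apply: ncob.
  move=> c cc sc; apply: (@homogeneous_eq f (fun=> 0)) => //; first by rewrite sc.
  - exact: fh.
  - by move=> r _; rewrite mxE.
  - move=> t a ec; have t0 : t = [::] by move: sc; rewrite ec size_rcons => -[/size0nil].
    by rewrite t0 comp // /component big1 // => r _; rewrite mxE.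
exists (assemble Psi); split; first by apply/cochainP => c _ _; apply: homogeneous_assemble.
move=> c cc sc; apply: homogeneous_eq => //; first by rewrite sc.
- exact: fh.
- by apply: homogeneous_cobound => // c' _ _; apply: homogeneous_assemble.
move=> t a ec; have st : size t = i.+1 by move: sc; rewrite ec size_rcons => -[].
have Vt : chain_in lt V t by rewrite -is_chain_rcons -ec.
rewrite comp // -st; case: t {ec} st Vt => // x t [st] Vt.
rewrite component_cobound //; apply: (@eq_coface_chain _ _ _ (@bruhat_lt_trans N) V (size t)) => // s Vs ss.
rewrite component_assemble; case: ifP => // /negbT h.
by have [_] := hPsi a; apply; rewrite // ss st.
Qed.

Lemma Ext_nonzeroI i a phi : rel_cocycle a i phi -> ~ rel_coboundary a i phi ->
  Ext_nonzero actM actN i.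
Proof.
(* The cocycle is placed in the component of [a]; the other components are zero. *)
move=> [cyc van] ncob; pose f := assemble (fun b t => if b == a then phi t else 0).
have fh c : homogeneous f c by exact: homogeneous_assemble.
have comp t : chain_in lt V t -> size t = i -> component a f t = phi t.
  by move=> Vt st; rewrite component_assemble eqxx; case: ifP => // /negbT /van->.
have comp' b t : b != a -> component b f t = 0.
  by move=> /negbTE ba; rewrite component_assemble ba; case: ifP.
exists f; split; first by apply/cochainP.
  move=> c cc sc; apply: (@homogeneous_eq _ (fun=> 0)) => //; first by rewrite sc.
  - exact: homogeneous_cobound.
  - by move=> r _; rewrite mxE.
  move=> t b ec; have st : size t = i.+1 by move: sc; rewrite ec size_rcons => -[].
  have Vt : chain_in lt V t by rewrite -is_chain_rcons -ec.
  rewrite [RHS]/component big1 => [|r _]; last by rewrite mxE.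
  rewrite -st; case: t {ec} st Vt => // x t st Vt; rewrite component_cobound //.
  case: (b =P a) => [->|/eqP ba].
    rewrite -[RHS](cyc _ Vt st).
    by apply: (@eq_coface_chain _ _ _ (@bruhat_lt_trans N) V i).
  rewrite -[RHS](@coface0 F _ (x :: t)).
  by apply: eq_coface => s _ _; apply: comp'.
case: i cyc van ncob comp => [|i] cyc van ncob comp.
  move=> f0; apply: ncob; exists (fun=> 0); split=> // -[|//] Vt _ /=.
  rewrite -comp // /component big1 // => r _.
  by rewrite f0 ?mxE // is_chain_rcons.
move=> [g [gc hg]]; apply: ncob; exists (component a g); split; last first.
  by move=> t _ _; apply: component0.
move=> t Vt st; rewrite -comp //; case: t Vt st => // x t Vt [st].
rewrite -component_cobound // /component; apply: eq_bigr => r _.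
by rewrite hg ?is_chain_rcons ?size_rcons -?st.
Qed.
End Ext.

(** * The grade of the simple module of a boolean permutation *)

Section Grade.
Variables (F : fieldType) (N : nat) (w : seq nat).
Hypotheses (wN : all (fun l => l < N) w) (uw : uniq w).
Notation Sn := {perm 'I_N.+1}.
Notation lt := (@bruhat_lt N.+1).
Notation sub_perm := (sub_perm N w).
Notation v := (word_perm N w).
Notation ks := (chain_starts w).
Implicit Types (x a : Sn).

Let V : pred Sn := [pred x | lt x v].
Let U a : pred Sn := fun x => lt x v && ~~ bruhat_le x a.

Lemma chain_starts_nil : ks = [::] -> w = [::].
Proof.
move=> e; apply/eqP; rewrite -size_eq0 -leqn0 leqNgt; apply/negP.
case ew : w => [//|l w'] _; have lw : l \in w by rewrite ew inE eqxx.
by have [s] := chain_set_cover lw; rewrite e.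
Qed.

(** The empty subword is the least element, and it is not [v] because [w] has a letter. *)
Lemma acyclic_below j : ks != [::] -> acyclic F lt V j.
Proof.
case eks : ks => [//|l s] _; have lw : l \in w.
  have : l \in ks by rewrite eks inE eqxx.
  by rewrite mem_filter => /andP[].
apply: (@acyclic_cone _ _ lt (@bruhat_lt_trans N) (@bruhat_lt_irr N) _ j (sub_perm pred0)).
  apply/andP; split; last exact: sub_perm_le_top.
  apply/eqP => e; suff : bruhat_le v (sub_perm pred0) by move/(top_le_sub_perm wN uw)/(_ l lw).
  by rewrite e bruhat_refl.
move=> x /andP[_ /(below_top wN uw)[S ->]].
case: (sub_perm pred0 =P sub_perm S) => [->|/eqP ne]; [by left|right].
by rewrite /bruhat_lt ne; apply: sub_perm_mono.
Qed.

Lemma chain_in_head a t : bruhat_le v a = false -> chain_in lt V t -> ~~ bruhat_le (head v t) a -> chain_in lt (U a) t.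
Proof.
move=> va; case: t => // x t /andP[/= xt /andP[Vx Vt]] xa.
apply/and3P; split=> //; first exact/andP.
apply/allP => y yt; move/allP/(_ y yt): (Vt) => Vy.
apply/andP; split=> //; apply: contra xa => ya.
have /andP[_ xy] : lt x y.
  by have := order_path_min (@bruhat_lt_trans N) xt => /allP/(_ y yt).
exact: connect_trans ya.
Qed.

Lemma U_generators a : exists2 G, U a =1 @upper_set N w G &
  all (fun g => count g ks <= 1) G /\ (~~ bruhat_le v a -> G <> [::]).
Proof.
have [G [hG cG]] := monotone_generators wN uw a; exists G.
  move=> x; rewrite /U /upper_set; case: (boolP (lt x v)) => //= /andP[_ /(below_top wN uw)[S ->]].
  exact: hG.
by split=> // va eG; have := hG xpredT; rewrite sub_perm_top va eG.
Qed.

Lemma U_obstruction : U (obs_perm N w) =1 @upper_set N w [seq chain_set w k | k <- ks].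
Proof.
move=> x; rewrite /U /upper_set; case: (boolP (lt x v)) => //= /andP[_ /(below_top wN uw)[S ->]].
rewrite has_map; apply/idP/hasP => [/(not_below_obs wN uw)[s sk h]|[s sk /= h]].
  by exists s => //=; apply: sub_perm_mono.
by apply: contra (chain_set_obs wN uw sk); apply: connect_trans h.
Qed.

Lemma grade_boolean : has_grade (simple_act F v) (size ks).
Proof.
case: (posnP (size ks)) => [k0|kpos].
  have w0 : w = [::] by apply/chain_starts_nil/size0nil.
  rewrite k0; split=> //.
  (* Without letters, nothing lies strictly below [v], and the value 1 on the empty chain gives a
     nonzero map from [L_v] to [A e_v]. *)
  apply: (@Ext_nonzeroI F N v 0 v (fun=> 1%R)).
    split; last by move=> [|//] _ _; rewrite bruhat_refl.
    move=> [|x [|//]] //= /andP[_ /andP[/= /andP[/eqP xv /(below_top wN uw)[S sub_perm]] _]].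
    by case: xv; rewrite sub_perm w0.
  move=> [psi [h _]]; have := h [::] isT erefl => /= /eqP.
  by rewrite GRing.oner_eq0.
have nks : ks != [::] by rewrite -size_eq0 -lt0n.
have aV j : acyclic F lt V j by apply: acyclic_below.
split; last first.
  move=> i ik; apply: Ext_zero => a phi [cyc van].
  (* If [v] is below [a], so is every [x] below [v]; the vanishing condition is then void, and
     acyclicity of [V] suffices. *)
  case: (boolP (bruhat_le v a)) => va.
    have [psi hpsi] := aV i phi cyc; exists psi; split=> // t Vt _ /negP; case.
    case: t Vt => // x t /andP[_ /andP[/andP[_ xv] _]]; exact: connect_trans va.
  case: i ik cyc van => [|i] ik cyc van.
    exists (fun=> 0%R); split=> // -[|//] Vt _ /=; exact: van.
  have [G eG [cG nG]] := U_generators a.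
  (* The antichain is that of the chain starts; the bound needed is [i.+1 < size ks]. *)
  have aU : acyclic F lt (U a) i.
    apply: (@acyclic_eq _ _ _ (@upper_set N w G)); first by move=> x; rewrite eG.
    apply: (@acyclic_upper_set F N w wN uw G ks) => //; last exact: nG.
    by move=> l; rewrite mem_filter => /andP[].
  have UV x : U a x -> V x by case/andP.
  have [|psi h1 h2] := relative_coboundary (@bruhat_lt_trans N) UV (@aV i.+1) aU cyc.
    move=> [|x t] // /andP[xt Ut] st; apply: van => //; last by case/andP: Ut => /andP[].
    by apply: (chUV UV); rewrite /chain_in xt.
  exists psi; split=> // t Vt [st] xa; apply: h2 => //.
  by apply: chain_in_head => //; apply/negbTE.
(* In degree [size ks], the obstruction gives an [a] for which [U a] is generated by the chains. *)
set a := obs_perm N w.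
have va : bruhat_le v a = false.
  case: (ks) nks (@chain_set_obs _ _ wN uw) => // s s' _ /(_ s); rewrite inE eqxx => /(_ isT) h.
  apply/negbTE; apply: contra h; apply: connect_trans; exact: sub_perm_le_top.
have cU : cyclic F lt (U a) (size ks).-1.
  apply: (@cyclic_eq _ _ _ (@upper_set N w [seq chain_set w k | k <- ks])).
    by move=> x; apply/esym; apply: U_obstruction.
  apply: cyclic_upper_set => //.
  - exact: chain_starts_uniq.
  - by apply/eqP.
  - by move=> l; rewrite mem_filter => /andP[].
  - by move=> k k' kk kk'; apply: (chain_set_start wN uw).
  - exact: chain_set_cover.
have UV x : U a x -> V x by case/andP.
have [phi [cyc van ncob]] := relative_cyclic (@bruhat_lt_trans N) UV (@aV _) cU.
rewrite -(prednK kpos); apply: (@Ext_nonzeroI F N v _ a phi).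
  split=> // t Vt st xa; apply: van => //; exact: chain_in_head.
move=> [psi [h1 h2]]; apply: ncob; exists psi => // c Uc sc.
apply: h2; rewrite ?sc //; first exact: (chUV UV).
case: c Uc {sc} => [|x c] /=; first by rewrite va.
by move=> /andP[_ /andP[/andP[]]].
Qed.
End Grade.

(** * Robinson-Schensted insertion *)

Section Schensted.
Implicit Types (r xs t : seq nat) (x y : nat).

Definition rs_tableau xs := foldl (fun tb x => rs_insert x tb) [::] xs.
Definition first_row r xs := foldl (fun r x => (rs_bump x r).1) r xs.
Fixpoint bumped r xs : seq nat :=
  if xs is x :: xs' then
    (if (rs_bump x r).2 is Some y then [:: y] else [::]) ++ bumped (rs_bump x r).1 xs'
  else [::].

(** Entries pushed out of the first row enter the lower rows in the same order, so the lower rows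
    can be studied as the tableau of the bumped word. *)
Lemma rs_foldl r tb xs : foldl (fun tb x => rs_insert x tb) (r :: tb) xs =
  first_row r xs :: foldl (fun tb x => rs_insert x tb) tb (bumped r xs).
Proof.
elim: xs r tb => //= x xs IH r tb; rewrite foldl_cat.
by case: (rs_bump x r) => r2 [y|] /=; rewrite IH.
Qed.

Lemma rs_tableau_rows x xs : rs_tableau (x :: xs) =
  first_row [::] (x :: xs) :: rs_tableau (bumped [::] (x :: xs)).
Proof. by rewrite /rs_tableau /= rs_foldl. Qed.

Variant bump_spec x r : seq nat * option nat -> Type :=
| BumpNone of all (fun y => y <= x) r : bump_spec x r (rcons r x, None)
| BumpSome r1 y r3 of r = r1 ++ y :: r3 & all (fun z => z <= x) r1 & x < y :
    bump_spec x r (r1 ++ x :: r3, Some y).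

Lemma bumpP x r : bump_spec x r (rs_bump x r).
Proof.
elim: r => [|y r IH] /=; first exact: (@BumpNone x [::]).
case: ltnP => xy; first exact: (@BumpSome x (y :: r) [::] y r).
case: IH => [h|r1 z r3 -> h xz].
  by apply: (@BumpNone x (y :: r)); rewrite /= xy.
by apply: (@BumpSome x _ (y :: r1) z r3); rewrite //= xy.
Qed.

Lemma size_row_bumped r xs :
  size (first_row r xs) + size (bumped r xs) = size r + size xs.
Proof.
elim: xs r => [|x xs IH] r //=; rewrite size_cat addnCA IH.
case: (bumpP x r) => [h|r1 y r3 -> h xy] /=; first by rewrite size_rcons; lia.
by rewrite !size_cat /=; lia.
Qed.

Lemma bump_sorted x r : sorted leq r -> sorted leq (rs_bump x r).1.
Proof.
rewrite !(sorted_pairwise leq_trans).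
case: (bumpP x r) => [h|r1 y r3 -> h xy] /=; first by rewrite pairwise_rcons h.
rewrite !pairwise_cat /= => /and3P[/allrelP h1 -> /andP[/allP h2 ->]] /=.
rewrite andbT; apply/andP; split; last by apply/allP => z /h2; lia.
apply/allrelP => a b ar; rewrite inE => /orP[/eqP->|br]; first exact: (allP h).
by apply: h1; rewrite // inE br orbT.
Qed.

Lemma first_row_sorted r xs : sorted leq r -> sorted leq (first_row r xs).
Proof. by elim: xs r => //= x xs IH r /(bump_sorted x)/IH. Qed.

Lemma first_row_rcons r xs x : first_row r (rcons xs x) = (rs_bump x (first_row r xs)).1.
Proof. by rewrite /first_row foldl_rcons. Qed.

Lemma bump_nth x r i : i < size r ->
  i < size (rs_bump x r).1 /\ nth 0 (rs_bump x r).1 i <= nth 0 r i.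
Proof.
case: (bumpP x r) => [h|r1 y r3 -> h xy] /= ir.
  by rewrite size_rcons nth_rcons ir; split=> //; lia.
move: ir; rewrite !size_cat !nth_cat /= => ir; split=> //.
by case: ifP => // ir1; case: (i - size r1) => //=; lia.
Qed.

Lemma bump_nth_new x r i : i <= size r -> (forall k, k < i -> nth 0 r k <= x) ->
  i < size (rs_bump x r).1 /\ nth 0 (rs_bump x r).1 i <= x.
Proof.
case: (bumpP x r) => [h|r1 y r3 -> h xy] /= ir small.
  rewrite size_rcons nth_rcons ltnS; split=> //; case: ltnP => h1.
    by apply: (allP h); apply: mem_nth.
  by case: eqP.
have ir1 : i <= size r1.
  rewrite leqNgt; apply/negP => /small; rewrite nth_cat ltnn subnn /=; lia.
rewrite size_cat nth_cat /=; split; first lia.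
case: ltnP => h1; first by apply: (allP h); apply: mem_nth.
by rewrite (_ : i - size r1 = 0) //; lia.
Qed.

Lemma subseq_rcons_case t xs x : subseq t (rcons xs x) ->
  subseq t xs \/ exists2 t', t = rcons t' x & subseq t' xs.
Proof.
case/lastP: t => [|t y]; first by left; apply: sub0seq.
case: (eqVneq y x) => [->|yx].
  move=> h; right; exists t => //; move: h.
  by rewrite -subseq_rev !rev_rcons /= eqxx subseq_rev.
rewrite -subseq_rev !rev_rcons /= (negbTE yx) -rev_rcons subseq_rev; by left.
Qed.

(** One half of Schensted's theorem. The induction also bounds the row entry in the column given by
    the length of [t] by the last entry of [t]. *)
Lemma first_row_max xs t : subseq t xs -> sorted leq t -> size t <= size (first_row [::] xs).
Proof.
case: (eqVneq t [::]) => [->//|nt] tx st; move: nt tx st.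
suff : t != [::] -> subseq t xs -> sorted leq t ->
  (size t).-1 < size (first_row [::] xs) /\
  nth 0 (first_row [::] xs) (size t).-1 <= last 0 t.
  by move=> H nt tx st; have [] := H nt tx st; case: (t).
elim/last_ind: xs t => [|xs x IH] t; first by case: t.
rewrite first_row_rcons; set r := first_row _ xs => nt /subseq_rcons_case[tx|[t' e t'x]] st.
  have [h1 h2] := IH t nt tx st; have [h3 h4] := bump_nth x h1.
  by split=> //; apply: leq_trans h4 h2.
move: st; rewrite e last_rcons size_rcons /= => st.
have sr : sorted leq r by apply: first_row_sorted.
case: (eqVneq t' [::]) => [->|nt'] /=; first by apply: bump_nth_new.
have st' : sorted leq t' by move: st; apply: subseq_sorted; [exact: leq_trans|exact: subseq_rcons].
have := IH t' nt' t'x st'; rewrite -/r => -[h1 h2]; have t'0 : 0 < size t' by rewrite lt0n size_eq0.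
apply: bump_nth_new; first by rewrite -(prednK t'0).
move=> k kt; apply: leq_trans (_ : nth 0 r (size t').-1 <= x).
  by apply: (sorted_leq_nth leq_trans leqnn 0 sr); rewrite ?inE //; lia.
apply: leq_trans h2 _; move: st; case/lastP: t' nt' {e t'x st' h1 t'0 kt} => // t' z _.
by rewrite (sorted_pairwise leq_trans) !pairwise_rcons all_rcons last_rcons => /andP[/andP[]].
Qed.

(** The other half: each entry of the row ends a nondecreasing subsequence whose length is the
    number of its column. *)
Lemma first_row_witness xs : exists t, [/\ subseq t xs, sorted leq t & size t = size (first_row [::] xs)].
Proof.
suff H : forall l, l < size (first_row [::] xs) -> exists t,
  [/\ subseq t xs, sorted leq t, size t = l.+1 & last 0 t = nth 0 (first_row [::] xs) l].
  case e : (size _) => [|l]; first by exists [::]; rewrite sub0seq.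
  by have [|t [h1 h2 h3 _]] := H l; [rewrite e|exists t].
elim/last_ind: xs => [|xs x IH] l //; rewrite first_row_rcons.
set r := first_row _ xs.
have old k : k < size r -> exists t, [/\ subseq t (rcons xs x), sorted leq t,
    size t = k.+1 & last 0 t = nth 0 r k].
  move=> /IH[t [h1 h2 h3 h4]]; exists t; split=> //.
  exact: subseq_trans h1 (subseq_rcons _ _).
have new k : k <= size r -> (forall k', k' < k -> nth 0 r k' <= x) ->
    exists t, [/\ subseq t (rcons xs x), sorted leq t, size t = k.+1 & last 0 t = x].
  case: k => [|k] kr small.
    by exists [:: x]; rewrite sub1seq mem_rcons inE eqxx.
  have [t [h1 h2 h3 h4]] := IH k kr; exists (rcons t x).
  rewrite size_rcons h3 last_rcons -!cats1 cat_subseq // ?subseq_refl //; split=> //.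
  case: t h2 h3 h4 {h1} => // z t h2 _ h4; rewrite cats1 /= rcons_path -[path _ _ _]/(sorted leq (z :: t)) h2.
  by rewrite -[last z t]/(last 0 (z :: t)) h4 small.
case: (bumpP x r) old new => [h|r1 y r3 e h xy] old new.
  rewrite /= size_rcons ltnS nth_rcons; case: ltngtP => // lr _; first exact: old.
  by apply: new; rewrite ?lr // => k kr; apply: (allP h); apply: mem_nth.
rewrite /= size_cat nth_cat /= => lr; case: (ltngtP l (size r1)) => lr1.
- by have := old l; rewrite e size_cat nth_cat lr1 /=; apply.
- have ln : (l < size r1) = false by lia.
  have := old l; rewrite e size_cat nth_cat ln -(subnSK lr1) /=; apply.
  by move: lr; lia.
- rewrite lr1 subnn /=; apply: new; first by rewrite e size_cat; lia.
  by move=> k kr; rewrite e nth_cat kr; apply: (allP h); apply: mem_nth.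
Qed.

Definition avoids321 xs := forall a b c, subseq [:: a; b; c] xs -> ~ c < b < a.

(** The invariant of the induction: [m] is the last bumped entry, and no entry less than [m], in the
    row or still to come, can be bumped any more. Bumping such an entry later would complete a
    pattern 321. *)
Lemma bumped_path r xs m :
  sorted leq r -> avoids321 xs ->
  (forall a b c, a \in r -> subseq [:: b; c] xs -> ~ c < b < a) ->
  (forall z x, z \in r -> z < m -> x \in xs -> z <= x) ->
  (forall z x, subseq [:: z; x] xs -> z < m -> z <= x) ->
  path leq m (bumped r xs).
Proof.
elim: xs r m => //= x xs IH r m sr av A Q1 Q2.
have av' : avoids321 xs.
  move=> a b c h; apply: av; exact: subseq_trans h (subseq_cons _ _).
have A' a b c : a \in x :: r -> subseq [:: b; c] xs -> ~ c < b < a.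
  rewrite inE => /orP[/eqP->|ar] h; first by apply: av; rewrite /= eqxx.
  by apply: (A a) => //; apply: subseq_trans h (subseq_cons _ _).
have pair z : z \in xs -> subseq [:: x; z] (x :: xs) by move=> zx; rewrite /= eqxx sub1seq.
have := bump_sorted x sr; case: (bumpP x r) A A' Q1 => [h|r1 y r3 e h xy] A A' Q1 /= s2.
  apply: IH => //.
  - by move=> a b c; rewrite mem_rcons; apply: A'.
  - move=> z x'; rewrite mem_rcons inE => /orP[/eqP->|zr] zm x'x.
      by apply: Q2 => //; apply: pair.
    by apply: Q1; rewrite // inE x'x orbT.
  - move=> z x' h' ; apply: Q2; exact: subseq_trans h' (subseq_cons _ _).
have yr : y \in r by rewrite e mem_cat inE eqxx orbT.
apply/andP; split.
  by rewrite leqNgt; apply/negP => /(Q1 y x yr); rewrite inE eqxx => /(_ isT); lia.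
apply: IH => //.
- move=> a b c ar; apply: A'; move: ar.
  by rewrite e !(mem_cat, inE) => /or3P[]->; rewrite ?orbT.
- move=> z x' zr zy x'x; rewrite leqNgt; apply/negP => x'z.
  have zx : z <= x.
    move: zr; rewrite mem_cat inE => /or3P[zr|/eqP->//|zr]; first exact: (allP h).
    move: sr; rewrite e (sorted_pairwise leq_trans) pairwise_cat /= => /and3P[_ _ /andP[/allP/(_ z zr)]].
    lia.
  by apply: (A y x x') => //; [apply: pair|lia].
- move=> z x' h' zy; rewrite leqNgt; apply/negP => x'z.
  by apply: (A' y z x'); rewrite // ?inE ?yr ?orbT // x'z.
Qed.

Lemma sorted_tableau r xs : sorted leq (r ++ xs) -> first_row r xs = r ++ xs /\ bumped r xs = [::].
Proof.
elim: xs r => [|x xs IH] r; first by rewrite cats0.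
rewrite -cat_rcons => srx; have := srx.
rewrite (sorted_pairwise leq_trans) pairwise_cat pairwise_rcons => /and3P[_ /andP[rx _] _].
have e : rs_bump x r = (rcons r x, None).
  case: (bumpP x r) => // r1 y r3 er _ xy; have := allP rx y.
  by rewrite er mem_cat inE eqxx orbT => /(_ isT); lia.
by rewrite /= e /=; apply: IH.
Qed.

(** The bumped word is sorted and forms a single second row, so the first row determines the
    shape. *)
Lemma shape_avoids321 xs : xs <> [::] -> avoids321 xs ->
  map size (rs_tableau xs) = size (first_row [::] xs) ::
    (if size xs - size (first_row [::] xs) is k.+1 then [:: k.+1] else [::]).
Proof.
case: xs => // x xs _ av; rewrite rs_tableau_rows.
have := size_row_bumped [::] (x :: xs).
have : sorted leq (bumped [::] (x :: xs)).
  by apply: (@path_sorted _ _ 0); apply: bumped_path.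
set b := bumped _ _; set r := first_row _ _ => sb; rewrite add0n => <-.
rewrite addKn /=; congr (_ :: _); case: b sb => // y b sb.
by have [e1 e2] := sorted_tableau (r := [::]) sb; rewrite rs_tableau_rows e1 e2.
Qed.

Lemma bump_split x r : exists a b, (rs_bump x r).1 = a ++ x :: b /\ all (fun y => y <= x) a.
Proof.
case: (bumpP x r) => [h|r1 y r3 _ h _]; first by exists r, [::]; rewrite cats1.
by exists r1, r3.
Qed.

(** Just after its insertion, [x1] is in the row behind entries that are at most [x1], so the first
    entry above [x2] is at most [x1]. *)
Lemma bump_descent x1 x2 r : x2 < x1 -> exists2 y, x2 < y <= x1 & (rs_bump x2 (rs_bump x1 r).1).2 = Some y.
Proof.
move=> x21; have [a [b [-> h]]] := bump_split x1 r.
elim: a h => [_|z a IH] /=; first by rewrite x21; exists x1; rewrite ?x21 /=.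
move=> /andP[zx /IH[y hy e]]; case: ltnP => h2; first by exists z; rewrite //= h2.
by exists y => //; move: e; case: (rs_bump x2 _).
Qed.

Lemma bumped_cat r xs ys : bumped r (xs ++ ys) = bumped r xs ++ bumped (first_row r xs) ys.
Proof. by elim: xs r => //= x xs IH r; rewrite IH catA. Qed.

Lemma bumped_descent A x1 x2 B : x2 < x1 -> bumped [::] (A ++ [:: x1, x2 & B]) <> [::].
Proof.
move=> h; rewrite bumped_cat /=; set r := first_row _ A.
have [y _ ->] := bump_descent r h.
by move/eqP; rewrite -!size_eq0 !size_cat /=; lia.
Qed.

(** The bumped entries satisfy [y3 <= x2 < y2], so the bumped word has a descent and needs two rows
    itself. *)
Lemma shape_descents A x1 x2 x3 B : x3 < x2 -> x2 < x1 ->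
  2 < size (rs_tableau (A ++ [:: x1, x2, x3 & B])).
Proof.
move=> h32 h21; set xs := A ++ _.
have rows ys : ys <> [::] -> rs_tableau ys = first_row [::] ys :: rs_tableau (bumped [::] ys).
  by case: ys => // z zs _; apply: rs_tableau_rows.
have [A' [y2 [y3 [B' [e h]]]]] : exists A' y2 y3 B', bumped [::] xs = A' ++ [:: y2, y3 & B'] /\ y3 < y2.
  rewrite /xs bumped_cat /=; set r := first_row _ A.
  have [y2 hy2 ->] := bump_descent r h21.
  have [y3 hy3 ->] := bump_descent (rs_bump x1 r).1 h32.
  by rewrite catA; eexists; exists y2, y3; eexists; split; [reflexivity|lia].
rewrite rows; last by rewrite /xs; case: (A).
rewrite e rows; last by case: (A').
rewrite rows; first by [].
exact: bumped_descent.
Qed.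
End Schensted.

(** * Shapes of boolean permutations and of longest parabolic elements *)

Section Shape.
Variable N : nat.
Notation Sn := {perm 'I_N.+1}.
Implicit Types (u v : Sn) (p q r : 'I_N.+1).

Definition one_line u : seq nat := [seq val (u i) | i <- enum 'I_N.+1].

Lemma rs_shapeE u : rs_shape u = map size (rs_tableau (one_line u)).
Proof. by []. Qed.

Lemma size_one_line u : size (one_line u) = N.+1.
Proof. by rewrite size_map size_enum_ord. Qed.

Lemma one_line_subseq u t : subseq t (one_line u) ->
  exists ps : seq 'I_N.+1, sorted (fun p q => p < q) ps /\ t = [seq val (u i) | i <- ps].
Proof.
case/subseqP => m _ ->; exists (mask m (enum 'I_N.+1)); rewrite map_mask; split=> //.
have tr : transitive (fun p q : 'I_N.+1 => p < q) by move=> ? ? ?; apply: ltn_trans.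
apply: (subseq_sorted tr (mask_subseq _ _)).
by have := iota_ltn_sorted 0 N.+1; rewrite -val_enum_ord sorted_map.
Qed.

Definition two_row_shape (n k : nat) : seq nat :=
  (n - k) :: (if k is k'.+1 then [:: k'.+1] else [::]).

(** An increasing subsequence misses a point of each of the disjoint inversions [(P k, Q k)], which
    bounds the first row from above. All inversions meet [R], so the points outside [R] form an
    increasing subsequence, which bounds it from below. *)
Lemma shape_of_inversions u (K : seq nat) (P Q : nat -> 'I_N.+1) (R : {set 'I_N.+1}) :
  (forall p q r, p < q -> q < r -> ~ u r < u q < u p) ->
  uniq K ->
  {in K, forall k, P k < Q k /\ u (Q k) < u (P k)} ->
  {in K &, forall k k', P k = P k' -> k = k'} ->
  {in K &, forall k k', Q k = Q k' -> k = k'} ->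
  {in K &, forall k k', P k <> Q k'} ->
  #|R| <= size K ->
  (forall p q, p < q -> u q < u p -> p \in R \/ q \in R) ->
  rs_shape u = two_row_shape N.+1 (size K) /\ size K <= N.+1.
Proof.
move=> av uK inv Pinj Qinj PQ Rk cov.
have avl : avoids321 (one_line u).
  move=> a b c /one_line_subseq[[|p [|q [|r [|? ?]]]] [sps e]] //.
  by case: e => -> -> ->; case/and3P: sps => pq qr _; apply: av pq qr.
have uP : uniq (map P K) by rewrite map_inj_in_uniq.
have kN : size K <= N.+1.
  by rewrite -[N.+1]card_ord -(size_map P) -(card_uniqP uP) max_card.
set row := size (first_row [::] (one_line u)).
have rowle : row <= N.+1 - size K.
  have [t [/one_line_subseq[ps [sps ->]] st szt]] := first_row_witness (one_line u).
  have tr : transitive (fun p q : 'I_N.+1 => p < q) by move=> ? ? ?; apply: ltn_trans.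
  have mono p q : p \in ps -> q \in ps -> p < q -> u p <= u q.
    move: sps st; rewrite (sorted_pairwise tr) (sorted_pairwise leq_trans) pairwise_map.
    elim: (ps) => //= z s IH /andP[/allP h1 s1] /andP[/allP h2 s2].
    rewrite !inE => /orP[/eqP->|ps1] /orP[/eqP->|qs1] pq; first by lia.
    - exact: h2.
    - by have := h1 p ps1; lia.
    - exact: IH.
  pose miss k := if P k \in ps then Q k else P k.
  have um : uniq (ps ++ map miss K).
    rewrite cat_uniq map_inj_in_uniq ?uK ?andbT; last first.
      move=> k k' kK kK'; rewrite /miss; case: ifP => _; case: ifP => _.
      - exact: Qinj.
      - by move/esym/(PQ _ _ kK' kK).
      - by move/(PQ _ _ kK kK').
      - exact: Pinj.
    apply/andP; split; first by apply: (sorted_uniq tr) sps => p; apply: ltnn.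
    apply/hasPn => _ /mapP[k kK ->]; rewrite /miss; have [h1 h2] := inv k kK.
    case: ifP => [Pps|-> //]; apply/negP => Qps.
    by have := mono _ _ Pps Qps h1; lia.
  have := max_card (mem (ps ++ map miss K)).
  rewrite (card_uniqP um) card_ord size_cat size_map.
  by move: szt; rewrite size_map -/row => ->; lia.
have rowge : N.+1 - size K <= row.
  pose ps := [seq p <- enum 'I_N.+1 | p \notin R].
  have szp : size ps = N.+1 - #|R|.
    have up : uniq ps by rewrite filter_uniq ?enum_uniq.
    rewrite -(card_uniqP up); transitivity #|~: R|; last by rewrite cardsCs setCK card_ord.
    by apply: eq_card => p; rewrite mem_filter mem_enum !inE andbT.
  apply: leq_trans (_ : size ps <= row); first by rewrite szp leq_sub2l.
  rewrite -(size_map (fun p => val (u p))) /row; apply: first_row_max.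
    by apply: map_subseq; apply: filter_subseq.
  apply: (@homo_sorted_in _ _ [pred p | p \notin R] _ (fun p q => p < q)) => /=.
  - move=> p q; rewrite !inE => pR qR pq; rewrite leqNgt; apply/negP => /(cov _ _ pq).
    by rewrite (negbTE pR) (negbTE qR); case.
  - by rewrite filter_all.
  - have tr : transitive (fun p q : 'I_N.+1 => p < q) by move=> ? ? ?; apply: ltn_trans.
    apply: (subseq_sorted tr (filter_subseq _ _)).
    by have := iota_ltn_sorted 0 N.+1; rewrite -val_enum_ord sorted_map.
have e : row = N.+1 - size K by apply/eqP; rewrite eqn_leq rowle.
split=> //; rewrite rs_shapeE shape_avoids321 //; last by move/(congr1 size); rewrite size_one_line.
by rewrite -/row size_one_line e /two_row_shape subKn.
Qed.
Lemma shape_consecutive u l : l.+2 < N.+1 ->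
  u (inord l.+1) < u (inord l) -> u (inord l.+2) < u (inord l.+1) -> 2 < size (rs_shape u).
Proof.
move=> lN h1 h2; rewrite rs_shapeE size_map.
have nthE k : k < N.+1 -> nth 0 (one_line u) k = u (inord k).
  move=> kN; rewrite (nth_map ord0) ?size_enum_ord //; congr (val (u _)).
  by apply/val_inj; rewrite /= nth_enum_ord // inordK.
rewrite -(cat_take_drop l (one_line u)).
rewrite (drop_nth 0) ?size_one_line; last lia.
rewrite (drop_nth 0) ?size_one_line; last lia.
rewrite (drop_nth 0) ?size_one_line; last lia.
by apply: shape_descents; rewrite !nthE //; lia.
Qed.

Section Boolean.
Variable w : seq nat.
Hypotheses (wN : all (fun l => l < N) w) (uw : uniq w).
Notation v := (word_perm N w).
Notation ks := (chain_starts w).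

Lemma boolean_inversion p q : p < q -> v q < v p ->
  exists l, [/\ l \in w, p <= l < q & v q <= l < v p].
Proof. by rewrite !word_permE // => pq h; apply: inversion_letter. Qed.

Lemma boolean_crossing_unique l p q : p <= l < v p -> q <= l < v q -> p = q.
Proof.
rewrite !word_permE // => /andP[h1 h2] /andP[h3 h4]; apply/val_inj.
exact: crossing_unique uw h1 h3 h2 h4.
Qed.

Lemma boolean_crossing_unique_down l p q : v p <= l < p -> v q <= l < q -> p = q.
Proof.
rewrite !word_permE // => /andP[h1 h2] /andP[h3 h4]; apply/val_inj.
apply: (can_inj (act_wordK w)); apply: (@crossing_unique (rev w) l);
  by rewrite ?rev_uniq ?act_wordK.
Qed.

(** The point [r] crosses the whole chain in its direction. Each gap is crossed by one point only in
    that direction, so an inversion across a gap of the chain involves [r]. *)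
Lemma chain_strand k : k \in ks -> exists r, forall l p q, chain_set w k l ->
  p <= l < q -> v q <= l < v p -> p = r \/ q = r.
Proof.
rewrite mem_filter => /andP[sts kw].
have [e ce] := complete_exists (letters_bound wN) kw sts.
have [ch eN fin] := ce; have [ke _ hJ hn] := ch.
have inC l : chain_set w k l -> k <= l <= e.
  by move=> /chainP cl; rewrite (complete_max ce (letters_bound wN) cl) andbT; case: cl.
have dir := chain_direction ch.
case: (boolP (letter_order w k)) => ok.
  have : up v k e.+1.
    apply/up_word_perm => //; split=> [l kl|l kl le]; first by apply: hJ; lia.
    by have := dir l; rewrite ok /letter_order => ->; lia.
  case/existsP=> r /andP[bruhat_rank er]; exists r => l p q /inC kl pl ql; left.
  by apply: (@boolean_crossing_unique l); lia.
have : down v k e.+1.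
  apply/down_word_perm => //; apply/(ascending_rev wN uw); split=> [l kl|l kl le]; first by apply: hJ; lia.
  by rewrite dir //; lia.
case/existsP=> r /andP[bruhat_rank er]; exists r => l p q /inC kl pl ql; right.
by apply: (@boolean_crossing_unique_down l); lia.
Qed.

Lemma strand_set (s : seq nat) : {subset s <= ks} -> exists2 R : {set 'I_N.+1},
  #|R| <= size s & forall k l p q, k \in s -> chain_set w k l ->
  p <= l < q -> v q <= l < v p -> p \in R \/ q \in R.
Proof.
elim: s => [|k s IH] sk; first by exists set0; rewrite ?cards0.
have [|R Rs hR] := IH; first by move=> z zs; apply: sk; rewrite inE zs orbT.
have [r hr] := chain_strand (sk k (mem_head _ _)).
exists (r |: R); first by rewrite cardsU1; apply: leq_add (leq_b1 _) Rs.
move=> z l p q; rewrite inE => /orP[/eqP->|zs] cl pl ql.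
  by case: (hr l p q cl pl ql) => ->; rewrite !inE eqxx; [left|right].
by case: (hR z l p q zs cl pl ql) => h; rewrite !inE h !orbT; [left|right].
Qed.

(** The points [P k] and [Q k] cross the gap [k] upwards and downwards. A point crossing the gaps of
    two starts in one direction would make the interval between them monotone, so these inversions
    are disjoint; the strands of the chains meet all inversions. *)
Lemma shape_boolean : rs_shape v = two_row_shape N.+1 (size ks) /\ size ks <= N.+1.
Proof.
have [R Rk hR] := strand_set (fun k (h : k \in ks) => h).
have exP k : k \in ks -> exists p, p <= k < v p.
  rewrite mem_filter => /andP[_ kw]; have : up v k k.+1.
    apply/up_word_perm => //; split=> [l kl|l kl le]; last lia.
    by rewrite (_ : l = k) //; lia.
  by case/existsP=> p; exists p.
have exQ k : k \in ks -> exists q, v q <= k < q.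
  rewrite mem_filter => /andP[_ kw]; have : down v k k.+1.
    apply/down_word_perm => //; split=> [l kl|l kl le]; last lia.
    by rewrite mem_rev (_ : l = k) //; lia.
  by case/existsP=> q; rewrite andbC; exists q.
pose P k := odflt ord0 [pick p : 'I_N.+1 | p <= k < v p].
pose Q k := odflt ord0 [pick q : 'I_N.+1 | v q <= k < q].
have PE k : k \in ks -> P k <= k < v (P k).
  by move=> /exP[p hp]; rewrite /P; case: pickP => [//|/(_ p)]; rewrite hp.
have QE k : k \in ks -> v (Q k) <= k < Q k.
  by move=> /exQ[p hp]; rewrite /Q; case: pickP => [//|/(_ p)]; rewrite hp.
have noasc k k' : k \in ks -> k' \in ks -> k < k' ->
    ~ (ascending w k k'.+1 \/ ascending (rev w) k k'.+1).
  rewrite !mem_filter => /andP[sk _] /andP[sk' _] kk [h|h].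
    by have := @monotone_chain_start (mem w) (letter_order w) k k'.+1 k k' h; rewrite sk sk'; lia.
  have := monotone_chain_start ((ascending_rev wN uw k k'.+1).1 h) (leqnn k) kk (ltnSn k').
  by rewrite !chain_start_flip sk sk' => /(_ isT).
have Plt k k' : k \in ks -> k' \in ks -> k < k' -> P k <> P k'.
  move=> kk kk' lt e; apply: (noasc k k') => //; left.
  have := PE k kk; have := PE k' kk'; rewrite -e word_permE // => h1 h2.
  by apply: (@crossing_ascending w k k'.+1 (P k)); rewrite //; lia.
have Qlt k k' : k \in ks -> k' \in ks -> k < k' -> Q k <> Q k'.
  move=> kk kk' lt e; apply: (noasc k k') => //; right.
  have := QE k kk; have := QE k' kk'; rewrite -e word_permE // => h1 h2.
  apply: (@crossing_ascending (rev w) k k'.+1 (act_word w (Q k))); rewrite ?rev_uniq ?act_wordK //; lia.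
apply: (@shape_of_inversions v ks P Q R) => //.
(* The middle point of a pattern 321 would have to move both down and up. *)
- move=> p q r pq qr /andP[h1 h2].
  have [l [_ hl hl']] := boolean_inversion pq h2.
  by have [l' [_ hm hm']] := boolean_inversion qr h1; lia.
- exact: chain_starts_uniq.
- by move=> k kk; have := PE k kk; have := QE k kk; lia.
- by move=> k k' kk kk' e; case: (ltngtP k k') => // h; [case: (Plt k k')|case: (Plt k' k)].
- by move=> k k' kk kk' e; case: (ltngtP k k') => // h; [case: (Qlt k k')|case: (Qlt k' k)].
- move=> k k' kk kk' e; have := PE k kk; have := QE k' kk'; rewrite e; lia.
- move=> p q pq h; have [l [lw hl hl']] := boolean_inversion pq h.
  have [k kk kl] := chain_set_cover lw; exact: hR kk kl hl hl'.
Qed.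
End Boolean.

Section Longest.
Variables (Jset : {set 'I_N.+1}) (u : Sn).
Hypothesis uJ : u \in parabolic Jset.
Hypothesis umax : forall x, x \in parabolic Jset -> coxlen x <= coxlen u.

Definition parabolic_letters : seq nat := [seq l <- iota 0 N | inord l \in Jset].
Notation K := parabolic_letters.

(** Otherwise a factor [sigma (inord l)] on the left would give a longer element of the subgroup. *)
Lemma longest_descent l : l \in K -> u (inord l.+1) < u (inord l).
Proof.
rewrite mem_filter mem_iota /= => /andP[lJ lN].
have lE : (inord l : 'I_N.+1) = l :> nat by rewrite inordK //; lia.
have l1E : (inord l.+1 : 'I_N.+1) = l.+1 :> nat by rewrite inordK.
rewrite ltnNge; apply/negP => h.
have lt : u (inord l) < u (inord l.+1).
  rewrite ltn_neqAle h andbT; apply/eqP => /val_inj/perm_inj e.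
  by have := lE; rewrite e l1E; lia.
have := @umax (sigma (inord l) * u)%g; rewrite groupM //; last first.
  by apply: mem_gen; apply/imsetP; exists (inord l); rewrite // inE lJ lE.
move=> /(_ isT); rewrite leqNgt sigma_tperm // => /negP; apply; apply: coxlen_tperm => //.
by rewrite lE l1E.
Qed.

(** The generators, hence the whole subgroup, stabilise the set of points up to [l]. *)
Lemma parabolic_preserves (l : nat) p : l < N -> l \notin K -> (u p <= l) = (p <= l).
Proof.
move=> lN lK; pose A := [set r : 'I_N.+1 | r <= l].
have sub : parabolic Jset \subset 'N(A | 'P)%g.
  rewrite gen_subG; apply/subsetP => _ /imsetP[j jJN ->]; have := jJN; rewrite inE => /andP[jJ jN].
  rewrite !inE; apply/subsetP => r; rewrite !inE /= /aperm.
  rewrite -[j]inord_val.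
  rewrite val_sigma // /adj_swap; have jl : j <> l :> nat.
    by move=> e; move: lK; rewrite mem_filter mem_iota /= lN -e inord_val jJ.
  by do !case: eqP => //; lia.
have := astabsP (subsetP sub _ uJ) p; rewrite !inE /=; exact.
Qed.

Lemma longest_inversion p q : p < q -> u q < u p -> forall l, p <= l < q -> l \in K.
Proof.
move=> pq h l hl; apply/negPn/negP => lK; have lN : l < N by have := ltn_ord q; lia.
by have := parabolic_preserves p lN lK; have := parabolic_preserves q lN lK; lia.
Qed.

Lemma longest_adjacent l : l \in K -> l.+1 \in K -> 2 < size (rs_shape u).
Proof.
move=> lK l1K; apply: (@shape_consecutive u l); try exact: longest_descent.
by move: l1K; rewrite mem_filter mem_iota => /andP[_]; lia.
Qed.

(** By [longest_inversion], an inversion between points that are not neighbours would need two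
    adjacent letters in [K]. So the inversions are the pairs [(l, l.+1)] with [l] in [K]. *)
Lemma longest_sparse : (forall l, l \in K -> l.+1 \notin K) ->
  [/\ rs_shape u = two_row_shape N.+1 (size K), size K <= N.+1 & coxlen u = size K].
Proof.
move=> sparse; have uK : uniq K by rewrite filter_uniq ?iota_uniq.
have KN l : l \in K -> l < N by rewrite mem_filter mem_iota => /andP[].
have lE l : l \in K -> (inord l : 'I_N.+1) = l :> nat by move=> /KN h; rewrite inordK //; lia.
have l1E l : l \in K -> (inord l.+1 : 'I_N.+1) = l.+1 :> nat by move=> /KN h; rewrite inordK.
have adj p q : p < q -> u q < u p -> q = p.+1 :> nat /\ val p \in K.
  move=> pq h; have inv := longest_inversion pq h; split; last by apply: inv; rewrite leqnn.
  case: (ltngtP q p.+1) => // h'; first lia.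
  have pK : val p \in K by apply: inv; rewrite /=; lia.
  by have := sparse _ pK; rewrite inv //=; lia.
pose R := [set (inord l : 'I_N.+1) | l : 'I_N & val l \in K].
have Rmem p : val p \in K -> p \in R.
  move=> pK; have pN := KN _ pK; apply/imsetP; exists (Ordinal pN).
    by rewrite inE.
  by rewrite /= inord_val.
have Rcard : #|R| <= size K.
  apply: leq_trans (leq_imset_card _ _) _.
  rewrite cardE -(size_map val); apply: uniq_leq_size.
    by rewrite map_inj_uniq ?enum_uniq //; apply: val_inj.
  by move=> _ /mapP[l lK ->]; move: lK; rewrite mem_enum inE.
have [h1 h2] : rs_shape u = two_row_shape N.+1 (size K) /\ size K <= N.+1.
  apply: (@shape_of_inversions u K (fun l => inord l) (fun l => inord l.+1) R) => //.
  - move=> p q r pq qr /andP[h1 h2].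
    have [e pK] := adj p q pq h2; have [_ qK] := adj q r qr h1.
    by have := sparse _ pK; rewrite -e qK.
  - by move=> l lK; rewrite lE // l1E // longest_descent.
  - by move=> l l' lK lK' e; rewrite -(lE l) // e lE.
  - by move=> l l' lK lK' e; apply/eqP; rewrite -eqSS -(l1E l) // e l1E.
  - move=> l l' lK lK' e; have := lE l lK; rewrite e l1E // => e'.
    by have := sparse l' lK'; rewrite e' lK.
  - by move=> p q pq h; left; apply: Rmem; case: (adj p q pq h).
split=> //; rewrite coxlenE.
pose f (l : nat) : 'I_N.+1 * 'I_N.+1 := (inord l, inord l.+1).
have uf : uniq (map f K).
  by rewrite map_inj_in_uniq // => l l' lK lK' [e _]; rewrite -(lE l) // e lE.
rewrite -(size_map f) -(card_uniqP uf); apply: eq_card => -[p q].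
apply/idP/mapP => [|[l lK [-> ->]]].
  rewrite inE /= => /andP[pq h]; have [e pK] := adj p q pq h.
  by exists (val p) => //; rewrite /f /= -e !inord_val.
by rewrite inE /= lE // l1E // ltnSn longest_descent.
Qed.
End Longest.

(** The shape determines the number of commuting reflections, so the length does not depend on the
    element that [pick] returns. *)
Lemma a_fun_boolean w : all (fun l => l < N) w -> uniq w ->
  a_fun (word_perm N w) = size (chain_starts w).
Proof.
move=> wN uw; have [shv kN] := shape_boolean wN uw; set k := size _ in shv kN *.
have shape_inj a b : a <= N.+1 -> b <= N.+1 -> two_row_shape N.+1 a = two_row_shape N.+1 b -> a = b.
  by move=> aN bN [e _]; lia.
rewrite /a_fun; case: pickP => [u /andP[/existsP[J /andP[uJ /forallP umax]] /eqP sh]|no].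
  have um x : x \in parabolic J -> coxlen x <= coxlen u by have := umax x => /implyP.
  have [l lK|s1 s2 s3] := longest_sparse uJ um.
    apply/negP => l1K; have := longest_adjacent uJ um lK l1K.
    by rewrite sh shv /two_row_shape; case: (k).
  by rewrite s3; apply: shape_inj => //; rewrite -s1 -shv.
(* It remains to exclude failure of [pick]: chain starts are never adjacent, so the longest element
   of the parabolic subgroup they generate has the required shape. *)
pose J := [set (inord l : 'I_N.+1) | l : 'I_N & val l \in chain_starts w].
have P1 : (1 : Sn)%g \in parabolic J by apply: group1.
pose u := [arg max_(x > (1 : Sn)%g in parabolic J) coxlen x].
have [uJ um] : u \in parabolic J /\ forall x, x \in parabolic J -> coxlen x <= coxlen u.
  by rewrite /u; case: arg_maxnP => // x.
have KE l : (l \in parabolic_letters J) = (l \in chain_starts w).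
  rewrite mem_filter mem_iota /=; apply/andP/idP => [[/imsetP[m mK e] lN]|lK].
    rewrite inE in mK; suff -> : l = m by [].
    have mN := ltn_ord m; have : (inord l : 'I_N.+1) = (inord m : 'I_N.+1) :> nat by rewrite e.
    by rewrite !inordK //; apply: ltnW.
  have lN : l < N by move: lK; rewrite mem_filter => /andP[_ /(allP wN)].
  by split=> //; apply/imsetP; exists (Ordinal lN); rewrite ?inE.
have eK : size (parabolic_letters J) = k.
  apply: perm_size; apply: uniq_perm; first by rewrite filter_uniq ?iota_uniq.
    exact: chain_starts_uniq.
  exact: KE.
have [l|s1 s2 s3] := longest_sparse uJ um.
  rewrite !KE !mem_filter chain_startS => /andP[-> lw].
  by rewrite /= orbF; apply/negP => /andP[/negP].
have := no u; rewrite shv s1 eK eqxx andbT => /negbT/negP; case.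
apply/existsP; exists J; rewrite uJ; apply/forallP => x; apply/implyP; exact: um.
Qed.
End Shape.

Theorem theorem6p7 (F : closedFieldType) (hF : [pchar F]%R =i pred0)
  (n : nat) (hn : (1 <= n)%N) (v : {perm 'I_n}) (hv : boolean_perm v) :
  has_grade (simple_act F v) (a_fun v).
Proof.
case: n hn v hv => // N _ v /boolean_word[w [wN uw ->]].
by rewrite a_fun_boolean //; apply: grade_boolean.
Qed.
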